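(* Let $n\ge 1$ and $m\ge 0$ be integers. Then $$\sum_{A} \operatorname{sgn}(A)\,(-1)^{\#\{\text{entries of }A\text{ decorated with the double arrow }\nwarrow\nearrow\}} \;=\; 2^n \prod_{i=1}^n \frac{(m-n+3i+1)_{i-1}\,(m-n+i+1)_i}{\left(\frac{m-n+i+2}{2}\right)_{i-1}\,(i)_i},$$ where the sum is over all arrowed Gelfand–Tsetlin patterns $A$ with $n$ rows whose entries are all integers in $\{0,1,\ldots,m\}$ and whose bottom row is strictly increasing.
   Context: A Gelfand–Tsetlin pattern with $n$ rows is a triangular array of integers $(a_{i,j})_{1\le j\le i\le n}$, row $i$ being $a_{i,1},\ldots,a_{i,i}$, drawn so that $a_{i-1,j}$ sits between $a_{i,j}$ and $a_{i,j+1}$, satisfying $a_{i+1,j}\le a_{i,j}\le a_{i+1,j+1}$ for all $1\le j\le i<n$. Row $n$ is the bottom row. For an entry $a_{i,j}$: its $\nwarrow$-neighbor is $a_{i-1,j-1}$ and its $\nearrow$-neighbor is $a_{i-1,j}$ (when they exist), its $\swarrow$-neighbor is $a_{i+1,j}$ and its $\searrow$-neighbor is $a_{i+1,j+1}$, and its left/right neighbors are $a_{i,j-1}$, $a_{i,j+1}$. An arrowed Gelfand–Tsetlin pattern is a Gelfand–Tsetlin pattern in which each entry either carries no decoration or carries exactly one decoration from $\{\nwarrow,\nearrow,\nwarrow\nearrow\}$ (the last one is called the double arrow), subject to: if an entry $a$ equals its $\nearrow$-neighbor and is decorated with $\nearrow$ or $\nwarrow\nearrow$, then the entry to the right of $a$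 in the same row also equals $a$ and is decorated with $\nwarrow$ or $\nwarrow\nearrow$; and if $a$ equals its $\nwarrow$-neighbor and is decorated with $\nwarrow$ or $\nwarrow\nearrow$, then the entry to the left of $a$ in the same row also equals $a$ and is decorated with $\nearrow$ or $\nwarrow\nearrow$. A special little triangle is an entry $a$ that equals both its $\swarrow$-neighbor $b$ and its $\searrow$-neighbor $c$, where $b$ is decorated with $\nearrow$ or $\nwarrow\nearrow$ and $c$ is decorated with $\nwarrow$ or $\nwarrow\nearrow$. The sign is $\operatorname{sgn}(A)=(-1)^{\#\text{special little triangles in }A}$. Pochhammer symbol: $(a)_k=a(a+1)\cdots(a+k-1)$, $(a)_0=1$. *)

(* Defs.v *)
From mathcomp Require Import all_boot all_order all_algebra.
Set Implicit Arguments. Unset Strict Implicit. Unset Printing Implicit Defensive.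
Import Order.TTheory GRing.Theory Num.Theory.

(* Conventions: rows r and columns c are 0-indexed: paper entry a_{i,j}
   is stored at position (r, c) = (i-1, j-1); valid positions satisfy c <= r < n.
   Row n-1 is the bottom row.  Entries live in 'I_(m.+1) = {0,...,m}.
   Decorations live in 'I_4 : 0 = none, 1 = NW, 2 = NE, 3 = double arrow NW NE. *)

Definition pos n := ('I_n * 'I_n)%type.

Definition get n (X : Type) (f : {ffun pos n -> X}) (x0 : X) (r c : nat) : X :=
  match insub r, insub c with
  | Some r', Some c' => f (r', c')
  | _, _ => x0
  end.

Definition dec_none : 'I_4 := ord0.
Definition hasNW (d : 'I_4) : bool := (val d == 1%N) || (val d == 3%N).
Definition hasNE (d : 'I_4) : bool := (val d == 2%N) || (val d == 3%N).
Definition isDouble (d : 'I_4) : bool := val d == 3%N.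

Section Patterns.
Variables (n m : nat).

Definition ent (a : {ffun pos n -> 'I_m.+1}) (r c : nat) : nat := val (get a ord0 r c).
Definition dec (d : {ffun pos n -> 'I_4}) (r c : nat) : 'I_4 := get d dec_none r c.

Definition normalized (a : {ffun pos n -> 'I_m.+1}) (d : {ffun pos n -> 'I_4}) : bool :=
  [forall p : pos n, (val p.1 < val p.2)%N ==> ((val (a p) == 0%N) && (val (d p) == 0%N))].

Definition GT_ok (a : {ffun pos n -> 'I_m.+1}) : bool :=
  [forall r : 'I_n, forall c : 'I_n,
     ((c <= r)%N && (r.+1 < n)%N) ==>
     ((ent a r.+1 c <= ent a r c)%N && (ent a r c <= ent a r.+1 c.+1)%N)].

Definition arrow_ok (a : {ffun pos n -> 'I_m.+1}) (d : {ffun pos n -> 'I_4}) : bool :=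
  [forall r : 'I_n, forall c : 'I_n, (c <= r)%N ==>
    [&&
      (* NE-neighbour a_{i-1,j} exists iff r >= 1 and c <= r-1 *)
      (((0 < r)%N && (c < r)%N && (ent a r c == ent a r.-1 c) && hasNE (dec d r c)) ==>
         ((ent a r c.+1 == ent a r c) && hasNW (dec d r c.+1))) &
      (* NW-neighbour a_{i-1,j-1} exists iff r >= 1 and c >= 1 *)
      (((0 < r)%N && (0 < c)%N && (ent a r c == ent a r.-1 c.-1) && hasNW (dec d r c)) ==>
         ((ent a r c.-1 == ent a r c) && hasNE (dec d r c.-1)))]].

Definition bottom_strict (a : {ffun pos n -> 'I_m.+1}) : bool :=
  [forall c : 'I_n, (c.+1 < n)%N ==> (ent a n.-1 c < ent a n.-1 c.+1)%N].

Definition arrowed_GT (p : {ffun pos n -> 'I_m.+1} * {ffun pos n -> 'I_4}) : bool :=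
  [&& normalized p.1 p.2, GT_ok p.1, arrow_ok p.1 p.2 & bottom_strict p.1].

(* special little triangles: entry (r,c) equal to its SW (r+1,c) and SE (r+1,c+1)
   neighbours, SW decorated with NE or double, SE with NW or double *)
Definition special_at (a : {ffun pos n -> 'I_m.+1}) (d : {ffun pos n -> 'I_4}) (r c : nat) : bool :=
  [&& (c <= r)%N, (r.+1 < n)%N, ent a r.+1 c == ent a r c, ent a r.+1 c.+1 == ent a r c,
      hasNE (dec d r.+1 c) & hasNW (dec d r.+1 c.+1)].

Definition num_special (p : {ffun pos n -> 'I_m.+1} * {ffun pos n -> 'I_4}) : nat :=
  #|[set q : pos n | special_at p.1 p.2 q.1 q.2]|.

Definition num_double (p : {ffun pos n -> 'I_m.+1} * {ffun pos n -> 'I_4}) : nat :=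
  #|[set q : pos n | (val q.2 <= val q.1)%N && isDouble (p.2 q)]|.

Definition sgn (p : {ffun pos n -> 'I_m.+1} * {ffun pos n -> 'I_4}) : rat :=
  (-1) ^+ num_special p.

End Patterns.

Definition poch (a : rat) (k : nat) : rat := \prod_(j < k) (a + j%:R).

(* Main.v *)
(* Fix x-coordinates X = (1 - t) / (1 + t) dual to the entries of a row.  Summing over the decorations and the
   entries of one row turns the signed number of patterns with bottom row k into 2^n (up to sign) times the value
   at t = 0 of Alt [ prod_i X_i^{k_i} prod_{i<j} (1 + t_i - t_j + t_i t_j) ] / prod_{i<j} (t_j - t_i): telescoping
   leaves a product over the row, and antisymmetry kills all but one way per position r of expanding it, which
   matches the expansion of the alternating sum with one more variable, put equal to 0.

   Summing over strictly increasing k <= m is a bounded Littlewood identity.  The sum satisfies a recursion in m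
   that is also satisfied by a sum over all sign changes of the t_i; the common identity behind it is a partial
   fraction expansion in u = t (1 + t) / (1 - t).  The sum over signs is a determinant of functions that are odd
   in every t_i, so at t = 0 one is left with
     D_n(M) = det_{0 <= i, l < n} [t^(2i+1)] (1 + t)^M u^l,     M = m + 2 - n.

   Finally 1 + u = (1 + t^2) / (1 - t), so that multiplying all columns by 1 + u or by u changes D_n(M) into
   D_n(M+1) or D_{n-1}(M+4), and a three-term Pluecker relation gives
     D_{n-1}(M+1) D_{n-1}(M+4) = D_n(M+1) D_{n-2}(M+4) - D_n(M) D_{n-2}(M+5).
   Together with D_n(0) = 0 it determines D_n(M), and the product formula satisfies it. *)
Require Import Defs.
From mathcomp Require Import all_boot all_order all_algebra all_fingroup.
From mathcomp Require Import ring lra zify.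
Set Implicit Arguments. Unset Strict Implicit. Unset Printing Implicit Defensive.
Import Order.TTheory GRing.Theory Num.Theory.
Local Open Scope ring_scope.

(** * Determinants of odd coefficients *)

(** The quotient of an alternating sum by the Vandermonde product is not formed in several
    variables. The [t i] are one-variable polynomials with zero constant term, curves through the
    origin, and Newton interpolation shows that the quotient exists and that its constant term is
    the same for all such curves. This freedom is used twice: the row step puts one coordinate equal
    to 0, and the Littlewood identity, which needs denominators, is proved in the fraction field for
    the curves [i.+1%:R *: 'X] and then cleared of them. The coordinate t is chosen so that the
    origin is x = 1 and x - 1 = -2 t / (1 + t): a geometric sum over one entry telescopes at the
    cost of a factor -2 t, and these factors are exactly what the Vandermonde product gains from the
    extra variable 0. *)

Definition odd_mx (R : comNzRingType) n (f : nat -> {poly R}) : 'M[R]_n :=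
  \matrix_(k, l) (f l)`_(k.*2.+1).

(** An even factor with constant term 1 mixes each odd coefficient only with lower odd ones, so it
    acts on the rows by a unitriangular matrix. *)
Lemma det_odd_mx_mul_even (R : comNzRingType) (c : R) n (f : nat -> {poly R}) :
  \det (odd_mx n (fun l => (1 + c *: 'X^2) * f l)) = \det (odd_mx n f).
Proof.
pose B : 'M[R]_n := \matrix_(k, j) ((k == j)%:R + c * (k == j.+1 :> nat)%:R).
have -> : odd_mx n (fun l => (1 + c *: 'X^2) * f l) = B *m odd_mx n f.
  apply/matrixP => k l; rewrite !mxE.
  rewrite mulrDl mul1r coefD -scalerAl coefZ coefXnM.
  under eq_bigr => j _ do rewrite !mxE mulrDl -mulrA.
  rewrite big_split /= -mulr_sumr; congr (_ + _ * _).
    rewrite (bigD1 k) //= eqxx mul1r big1 ?addr0 // => j /negPf hj.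
    by rewrite eq_sym hj mul0r.
  case: k => [[|k] hk] /=.
    by rewrite big1 // => j _; rewrite mul0r.
  have hk' : (k < n)%N by apply: ltn_trans hk.
  rewrite (bigD1 (Ordinal hk')) //= eqxx mul1r big1 ?addr0 => [|j hj].
    by congr (_`_ _).
  rewrite eqSS; case: eqP => [e|_]; last by rewrite mul0r.
  by case/eqP: hj; apply: val_inj.
rewrite det_mulmx det_trig ?big1 ?mul1r //.
  by move=> i _; rewrite !mxE eqxx (ltn_eqF (ltnSn _)) mulr0 addr0.
apply/is_trig_mxP => i j hij; rewrite !mxE.
rewrite -[i == j]/(i == j :> nat) (ltn_eqF hij) add0r.
by rewrite (ltn_eqF (leqW hij)) mulr0.
Qed.

Definition fcons T (x : T) (f : nat -> T) (l : nat) : T := if l is l'.+1 then f l' else x.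

Lemma det_odd_mx_rot (R : comNzRingType) n (f : nat -> {poly R}) :
  \det (odd_mx n.+1 (fcons (f n) f)) = (-1) ^+ n * \det (odd_mx n.+1 f).
Proof.
have -> : odd_mx n.+1 (fcons (f n) f)
   = col_perm (lift_perm ord0 ord_max 1%g) (odd_mx n.+1 f).
  apply/matrixP => k l; rewrite !mxE.
  case: (unliftP ord0 l) => [l' ->|->]; last by rewrite lift_perm_id.
  by rewrite lift_perm_lift perm1 lift0 lift_max.
rewrite col_permE det_mulmx det_perm mulrC odd_permV odd_lift_perm odd_perm1 /=.
by rewrite addbF signr_odd.
Qed.

(** The square matrix [N] has columns [y], [x], [T 0], ..., [T n]; its last row is the functional
    [lam], the minor obtained by putting a column in front of [T 0], ..., [T (n - 1)]. As [lam]
    reads only the first n + 1 odd coefficients, this row depends on the others, and expanding the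
    zero determinant along it gives the relation. *)
Lemma plucker_odd_mx (R : fieldType) n (y x : {poly R}) (T : nat -> {poly R}) :
  \det (odd_mx n.+1 (fcons y T)) * \det (odd_mx n.+2 (fcons x T))
  - \det (odd_mx n.+1 (fcons x T)) * \det (odd_mx n.+2 (fcons y T))
  + \det (odd_mx n.+1 T) * \det (odd_mx n.+2 (fcons y (fcons x T))) = 0.
Proof.
pose lam f := \det (odd_mx n.+1 (fcons f T)).
pose c := fcons y (fcons x T).
pose N : 'M[R]_n.+3 :=
  \matrix_(i, j) (if (i < n.+2)%N then (c j)`_(i.*2.+1) else lam (c j)).
have lamE f : lam f = \sum_(k < n.+1) f`_(k.*2.+1) * cofactor (odd_mx n.+1 (fcons 0 T)) k ord0.
  rewrite /lam (expand_det_col _ ord0); apply: eq_bigr => k _; rewrite mxE; congr (_ * _).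
  rewrite /cofactor; congr (_ * \det _); apply/matrixP => i j; rewrite !mxE.
  by rewrite lift0.
have lamT j : (j < n)%N -> lam (T j) = 0.
  move=> hj; rewrite /lam -det_tr.
  have hj' : (j.+1 < n.+1)%N by [].
  apply: (@determinant_alternate _ _ _ ord0 (Ordinal hj')) => // k.
  by rewrite !mxE.
have N0 : \det N = 0.
  apply/eqP/det0P.
  (* The dependency between the rows: the coefficients of [lam] on the first n + 1 rows, 0 on the
     next one, -1 on the last. *)
  pose v : 'rV[R]_n.+3 := \row_i (if (i < n.+1)%N then cofactor (odd_mx n.+1 (fcons 0 T)) (inord i) ord0
      else if i == ord_max then -1 else 0).
  exists v.
    apply/eqP => /rowP /(_ ord_max); rewrite !mxE eqxx; case: ifP => [|_ /eqP].
      by move=> /=; lia.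
    by rewrite oppr_eq0 oner_eq0.
  apply/rowP => j; rewrite !mxE.
  rewrite big_ord_recr big_ord_recr /= !mxE eqxx /=.
  have -> : (n.+1 < n.+1)%N = false by lia.
  have -> : (n.+2 < n.+1)%N = false by lia.
  have -> : (n.+2 < n.+2)%N = false by lia.
  rewrite -(inj_eq val_inj) /= (ltn_eqF (ltnSn _)) mul0r addr0 mulN1r.
  apply/eqP; rewrite subr_eq0; apply/eqP; rewrite lamE; apply: eq_bigr => k _.
  rewrite !mxE /= ltn_ord (ltn_trans (ltn_ord k) (ltnSn _)) mulrC; congr (_ * cofactor _ _ _).
  by apply: val_inj; rewrite /= inordK.
have minorN (j : 'I_n.+3) (f : nat -> {poly R}) :
    (forall l : 'I_n.+2, c (lift j l) = f l) ->
    cofactor N ord_max j = (-1) ^+ (n.+2 + j) * \det (odd_mx n.+2 f).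
  move=> h; congr (_ * \det _); apply/matrixP => i l; rewrite !mxE.
  by rewrite lift_max ltn_ord h.
move: N0; rewrite (expand_det_row _ ord_max).
(* Only the columns [y], [x] and [T n] survive, since [lam] kills the other [T j]. *)
rewrite big_ord_recl big_ord_recl big_ord_recr big1 /=; last first.
  move=> i _; rewrite !mxE /= ltnn lamT ?mul0r //.
  exact: ltn_ord.
rewrite !mxE /= !ltnn.
rewrite (minorN _ (fcons x T)); last first.
  by move=> l; rewrite /c lift0.
rewrite (minorN _ (fcons y T)); last first.
  by move=> l; case: l => [[|l] hl].
rewrite (minorN _ (fcons y (fcons x T))); last first.
  move=> l; rewrite -/c; congr (c _); rewrite /= /bump /=.
  by have := ltn_ord l; rewrite ltnNge => /negPf ->.
rewrite /c /= /bump /= !add1n /=.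
rewrite /lam det_odd_mx_rot -/(lam _) -/(lam _).
have -> : (n.+2 + 0 = n.+2)%N by lia.
rewrite !(exprD, exprS) expr0.
have [->|->] : (-1) ^+ n = 1 :> R \/ (-1) ^+ n = -1 :> R.
- by rewrite -signr_odd; case: odd; [right|left].
- by move=> <-; ring.
- by move=> H; apply/oppr_inj; rewrite oppr0 -[RHS]H; ring.
Qed.

Lemma eq_odd_mx (R : comNzRingType) n (f g : nat -> {poly R}) :
  (forall l, (l < n)%N -> f l = g l) -> odd_mx n f = odd_mx n g.
Proof. by move=> h; apply/matrixP => k l; rewrite !mxE h. Qed.

(** The predicate [P] lets the column operation start only after the first one or two columns, as
    [tau_det_plucker] requires. *)
Lemma det_odd_mx_add_prev (R : comNzRingType) n (P : pred nat) (f : nat -> {poly R}) :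
  ~~ P 0%N ->
  \det (odd_mx n (fun l => f l + (if P l then f l.-1 else 0))) = \det (odd_mx n f).
Proof.
move=> P0.
pose B : 'M[R]_n := \matrix_(j, l) ((j == l)%:R + (P l && (j.+1 == l :> nat))%:R).
have -> : odd_mx n (fun l => f l + (if P l then f l.-1 else 0)) = odd_mx n f *m B.
  apply/matrixP => k l; rewrite !mxE coefD.
  under eq_bigr => j _ do rewrite !mxE mulrDr.
  rewrite big_split /=; congr (_ + _).
    rewrite (bigD1 l) //= eqxx mulr1 big1 ?addr0 // => j /negPf hj.
    by rewrite hj mulr0.
  case Pl: (P l); last by rewrite coef0 big1 // => j _; rewrite mulr0.
  case: l Pl => [[|l] hl] /= Pl; first by rewrite Pl in P0.
  have hl' : (l < n)%N by apply: ltn_trans hl.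
  rewrite (bigD1 (Ordinal hl')) //= eqxx mulr1 big1 ?addr0 // => j hj.
  rewrite eqSS; case: eqP => [e|_]; last by rewrite mulr0.
  by case/eqP: hj; apply: val_inj.
suff dB : \det B = 1 by rewrite det_mulmx dB mulr1.
rewrite -det_tr det_trig ?big1 //.
  by move=> i _; rewrite !mxE eqxx (gtn_eqF (ltnSn _)) andbF addr0.
apply/is_trig_mxP => i j hij; rewrite !mxE.
rewrite -[j == i]/(j == i :> nat) (gtn_eqF hij) add0r.
by rewrite (gtn_eqF (leqW hij)) andbF.
Qed.

Lemma det_odd_mx_col0_add (R : comNzRingType) n (x y : {poly R}) (f : nat -> {poly R}) :
  \det (odd_mx n.+2 (fcons (x + y) (fcons y f))) = \det (odd_mx n.+2 (fcons x (fcons y f))).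
Proof.
pose B : 'M[R]_n.+2 := \matrix_(j, l) ((j == l)%:R + ((l == 0 :> nat) && (j == 1 :> nat))%:R).
have -> : odd_mx n.+2 (fcons (x + y) (fcons y f)) = odd_mx n.+2 (fcons x (fcons y f)) *m B.
  apply/matrixP => k l; rewrite !mxE.
  under eq_bigr => j _ do rewrite !mxE mulrDr.
  rewrite big_split /= (bigD1 l) //= eqxx mulr1 [X in _ + X + _]big1 ?addr0; last first.
    by move=> j /negPf hj; rewrite hj mulr0.
  case: l => [[|l] hl] /=; last by rewrite big1 ?addr0 // => j _; rewrite mulr0.
  rewrite coefD (bigD1 (lift ord0 ord0)) //= mulr1 big1 ?addr0 // => j hj.
  case: eqP => [e|_]; last by rewrite mulr0.
  by case/eqP: hj; apply: val_inj.
suff dB : \det B = 1 by rewrite det_mulmx dB mulr1.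
rewrite det_trig ?big1 //.
  by move=> i _; rewrite !mxE eqxx; case: i => [[|i] hi]; rewrite addr0.
apply/is_trig_mxP => i j hij; rewrite !mxE.
rewrite -[i == j]/(i == j :> nat) (ltn_eqF hij) add0r.
by case: (nat_of_ord j) hij.
Qed.

Section TauDet.
Variable R : comNzRingType.

(* Up to the common factor [(1 + 'X) ^+ a * (1 - 'X) ^+ b] this is the [l]-th power of
   [u = 'X (1 + 'X) / (1 - 'X)]. *)
Definition tau_pol (a b l : nat) : {poly R} := 'X^l * (1 + 'X) ^+ (a + l) * (1 - 'X) ^+ (b - l).
Definition tau_det n a b := \det (odd_mx n (tau_pol a b)).

Lemma tau_pol_SS a b l : (l <= b)%N -> tau_pol a.+1 b.+1 l = (1 + (-1) *: 'X^2) * tau_pol a b l.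
Proof.
move=> h; rewrite /tau_pol addSn subSn // !exprS scaleN1r; ring.
Qed.

(** This is 1 + u = (1 + t^2) / (1 - t) with denominators cleared. *)
Lemma tau_pol_add a b l : (l <= b)%N ->
  tau_pol a b.+1 l + tau_pol a b.+1 l.+1 = (1 + 1 *: 'X^2) * tau_pol a b l.
Proof.
by move=> h; rewrite /tau_pol subSS subSn // addnS !exprS scale1r; ring.
Qed.

(** The even factor (1 + t)(1 - t) is free, so only [a - b] matters; a large [b] merely keeps the
    exponents [b - l] from being truncated. *)
Lemma tau_det_SS n a b : (n <= b.+1)%N -> tau_det n a.+1 b.+1 = tau_det n a b.
Proof.
move=> h; rewrite /tau_det -[RHS](det_odd_mx_mul_even (-1)); congr (\det _).
by apply: eq_odd_mx => l hl; rewrite tau_pol_SS //; lia.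
Qed.

(** All columns are divisible by t, so the first row is (1, 0, ..., 0). The remaining columns are
    divisible by t^2, and removing t^2 turns the coefficient 2k + 3 into 2k + 1. *)
Lemma tau_det_shift n a b : \det (odd_mx n.+1 (fun l => tau_pol a b.+2 l.+1)) = tau_det n a.+2 b.
Proof.
rewrite (expand_det_row _ ord0) big_ord_recl big1 => [|i _]; last first.
  by rewrite !mxE lift0 /tau_pol -mulrA coefXnM /= mul0r.
rewrite !mxE addr0 /tau_pol -mulrA coefXnM /= -horner_coef0 !hornerE /= !expr1n.
rewrite subr0 expr1n expr0 !mul1r; congr (\det _).
apply/matrixP => k l; rewrite !mxE !lift0 /tau_pol -[LHS]/(_`_ _) -mulrA -[in RHS]mulrA !coefXnM doubleS.
by rewrite !subSS !addSn !addnS.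
Qed.

End TauDet.

(* Pluecker relation between the columns [1 + u], [u] and [u ^+ l.+1 * (1 + u)].  A common factor [1 + u]
   of the columns amounts to the even factor [1 + 'X^2] and lowers [b] by one, while a common factor [u]
   turns odd coefficients into even ones, the first column becoming trivial. *)
Lemma tau_det_plucker (R : fieldType) n a b : (n.+2 < b)%N ->
  tau_det R n.+1 a b.-1 * tau_det R n.+1 a.+2 b.-2
  = tau_det R n a.+2 b.-2 * tau_det R n.+2 a b.-1 - tau_det R n a.+2 b.-1.-2 * tau_det R n.+2 a b.
Proof.
case: b => [|[|b]] // hb; rewrite /=.
pose f := tau_pol R a b.+2.
have hT l : (l <= b.+1)%N -> f l + f l.+1 = (1 + 1 *: 'X^2) * tau_pol R a b.+1 l by apply: tau_pol_add.
have := plucker_odd_mx n (f 0%N + f 1%N) (f 1%N) (fun l => f l.+1 + f l.+2).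
have e1 k : (k <= n.+2)%N -> \det (odd_mx k (fcons (f 0%N + f 1%N) (fun l => f l.+1 + f l.+2))) = tau_det R k a b.+1.
  move=> hk; rewrite /tau_det -[RHS](det_odd_mx_mul_even 1); congr (\det _); apply: eq_odd_mx => l hl.
  by rewrite -hT; [case: l hl | lia].
have e2 k : \det (odd_mx k.+1 (fcons (f 1%N) (fun l => f l.+1 + f l.+2))) = tau_det R k a.+2 b.
  rewrite -tau_det_shift -[RHS](det_odd_mx_add_prev _ (P := fun l => (0 < l)%N)) //; congr (\det _).
  by apply: eq_odd_mx => -[|l] hl /=; rewrite ?addr0 // addrC.
rewrite !e1 ?e2 ?leqnSn //.
have -> : \det (odd_mx n.+1 (fun l => f l.+1 + f l.+2)) = tau_det R n a.+2 b.-1.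
  have hb' : (n < b)%N by [].
  case: b hb' @f hT e1 e2 {hb} => // b hb f hT _ _.
  rewrite -tau_det_shift -[RHS](det_odd_mx_mul_even 1); congr (\det _).
  by apply: eq_odd_mx => l hl; rewrite hT //; lia.
have -> : \det (odd_mx n.+2 (fcons (f 0%N + f 1%N) (fcons (f 1%N) (fun l => f l.+1 + f l.+2))))
   = tau_det R n.+2 a b.+2.
  rewrite det_odd_mx_col0_add /tau_det -/f -[RHS](det_odd_mx_add_prev _ (P := fun l => (1 < l)%N)) //.
  congr (\det _); apply: eq_odd_mx => -[|[|l]] hl /=; rewrite ?addr0 //.
  by rewrite addrC.
move=> H; apply/eqP; rewrite -subr_eq0; apply/eqP; rewrite -[RHS]H; ring.
Qed.

(** The first column is (1 - t^2)^b, an even polynomial. *)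
Lemma tau_det_diag0 (R : comNzRingType) n b : tau_det R n.+1 b b = 0.
Proof.
rewrite /tau_det (expand_det_col _ ord0) big1 // => i _.
rewrite !mxE /tau_pol expr0 mul1r addn0 subn0 -exprMn.
have -> : (1 + 'X) * (1 - 'X) = 1 + (-1) *: 'X^2 :> {poly R} by rewrite scaleN1r; ring.
have -> : (1 + (-1) *: 'X^2) ^+ b = ((1 - 'X) ^+ b) \Po 'X^2 :> {poly R}.
  by rewrite rmorphXn /= comp_polyB comp_polyX rmorph1 scaleN1r.
by rewrite coef_comp_poly_Xn // dvdn2 /= odd_double /= mul0r.
Qed.

(** * The product formula *)

Lemma poch0 a : poch a 0 = 1. Proof. by rewrite /poch big_ord0. Qed.
Lemma pochS a k : poch a k.+1 = poch a k * (a + k%:R).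
Proof. by rewrite /poch big_ord_recr. Qed.
Lemma pochSl a k : poch a k.+1 = a * poch (a + 1) k.
Proof.
rewrite /poch big_ord_recl addr0; congr (_ * _); apply: eq_bigr => i _.
by rewrite lift0 -addrA -natr1 [1 + _]addrC.
Qed.
Lemma pochD a j k : poch a (j + k) = poch a j * poch (a + j%:R) k.
Proof.
elim: k => [|k IH]; first by rewrite addn0 poch0 mulr1.
by rewrite addnS !pochS IH natrD -mulrA -addrA.
Qed.
Lemma poch_gt0 a k : 0 < a -> 0 < poch a k.
Proof. by move=> ha; apply: prodr_gt0 => i _; rewrite ltr_wpDr. Qed.

(** 2^n times the Pochhammer symbol at (x + n + 1) / 2 in the denominator of the formula. *)
Definition half_prod (x : rat) n : rat := \prod_(j < n) (x + n.+1%:R + (2 * j)%:R).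
(** At x = m - n + 2 this is the i-th factor of the theorem. *)
Definition rhs_factor (x : rat) i : rat :=
  poch (x + 3%:R * i%:R - 1) i.-1 * poch (x + i%:R - 1) i
  / (poch ((x + i%:R) / 2%:R) i.-1 * poch i%:R i).
Definition rhs_prod (x : rat) n : rat := \prod_(1 <= i < n.+1) rhs_factor x i.

Lemma rhs_prod0 x : rhs_prod x 0 = 1. Proof. by rewrite /rhs_prod big_nil. Qed.
Lemma rhs_prodS x n : rhs_prod x n.+1 = rhs_prod x n * rhs_factor x n.+1.
Proof. by rewrite /rhs_prod big_nat_recr. Qed.

Lemma poch_half x n : poch ((x + n.+1%:R) / 2%:R) n = half_prod x n / 2%:R ^+ n.
Proof.
transitivity (\prod_(j < n) ((x + n.+1%:R + (2 * j)%:R) / 2%:R)).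
  by apply: eq_bigr => j _; rewrite natrM; field.
by rewrite big_split /= prodr_const card_ord exprVn.
Qed.

Lemma rhs_factorS x n : rhs_factor x n.+1 = poch (x + 3%:R * n%:R + 2%:R) n * poch (x + n%:R) n.+1
   * 2%:R ^+ n / (half_prod x n * poch n.+1%:R n.+1).
Proof.
rewrite /rhs_factor /= poch_half.
have -> : x + 3%:R * n.+1%:R - 1 = x + 3%:R * n%:R + 2%:R by rewrite -[n.+1]addn1 natrD; ring.
have -> : x + n.+1%:R - 1 = x + n%:R by rewrite -[n.+1]addn1 natrD; ring.
by rewrite !invfM invrK -!mulrA; congr (_ * (_ * _)); rewrite mulrCA mulrA.
Qed.

Lemma half_prod_gt0 x n : 0 <= x -> 0 < half_prod x n.
Proof.
move=> hx; apply: prodr_gt0 => j _; rewrite ltr_wpDr ?ler0n //.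
by rewrite ltr_wpDl // ltr0n.
Qed.

Lemma half_prodS x n : half_prod x n.+1 = half_prod (x + 1) n * (x + 3%:R * n%:R + 2%:R).
Proof.
rewrite /half_prod big_ord_recr /=; congr (_ * _).
  by apply: eq_bigr => j _; rewrite -[n.+2]addn1 natrD; ring.
by rewrite natrM -[n.+2]addn2 natrD; ring.
Qed.

Lemma half_prodSl x n : half_prod x n.+1 = (x + n%:R + 2%:R) * half_prod (x + 3%:R) n.
Proof.
rewrite /half_prod big_ord_recl; congr (_ * _); first by rewrite muln0 addr0 -[n.+2]addn2 natrD addrA.
apply: eq_bigr => j _; rewrite lift0 !natrM -[n.+2]addn2 -[n.+1]addn1 -[j.+1]addn1 !natrD; ring.
Qed.

Lemma poch_nn_gt0 n : 0 < poch n.+1%:R n.+1. Proof. by rewrite poch_gt0 ?ltr0n. Qed.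

Lemma poch_nnS n : poch n.+2%:R n.+2 = 2%:R * (2%:R * n%:R + 3%:R) * poch n.+1%:R n.+1.
Proof.
rewrite pochS [poch n.+2%:R n.+1]pochS [poch n.+1%:R n.+1]pochSl.
have -> : n.+1%:R + 1 = n.+2%:R :> rat by rewrite natr1.
rewrite -[n.+2]addn2 -[n.+1]addn1 !natrD; ring.
Qed.

Lemma rhs_factor_gt0 x n : 0 < x -> 0 < rhs_factor x n.+1.
Proof.
move=> hx; rewrite rhs_factorS.
have h2 : 0 <= n%:R :> rat by rewrite ler0n.
apply: divr_gt0; last by rewrite mulr_gt0 ?half_prod_gt0 ?poch_nn_gt0 // ltW.
by rewrite !mulr_gt0 ?poch_gt0 ?exprn_gt0 ?ltr0n //; lra.
Qed.

Lemma rhs_prod_gt0 x n : 0 < x -> 0 < rhs_prod x n.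
Proof.
move=> hx; elim: n => [|n IH]; first by rewrite rhs_prod0.
by rewrite rhs_prodS mulr_gt0 // rhs_factor_gt0.
Qed.

(** Stated without division because [poch x n] vanishes at x = 0 for n > 0. In each new factor a
    Pochhammer symbol is read from its two ends. *)
Lemma rhs_prod_shift x n : 0 <= x ->
  rhs_prod (x + 1) n * half_prod x n * poch x n
  = rhs_prod x n * \prod_(i < n) ((x + 4%:R * i%:R + 2%:R) * (x + 2%:R * i%:R + 1)).
Proof.
move=> hx; elim: n => [|n IH].
  by rewrite !rhs_prod0 /half_prod poch0 !big_ord0.
rewrite !rhs_prodS half_prodS pochS big_ord_recr /= !rhs_factorS.
have h2 : 0 <= n%:R :> rat by rewrite ler0n.
have n1 : half_prod (x + 1) n != 0 by rewrite gt_eqF // half_prod_gt0 //; lra.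
have n2 : half_prod x n != 0 by rewrite gt_eqF // half_prod_gt0.
have n3 : poch n.+1%:R n.+1 != 0 by rewrite gt_eqF // poch_nn_gt0.
have e1 : poch (x + 1 + 3%:R * n%:R + 2%:R) n * (x + 3%:R * n%:R + 2%:R)
   = poch (x + 3%:R * n%:R + 2%:R) n * (x + 4%:R * n%:R + 2%:R).
  have := pochSl (x + 3%:R * n%:R + 2%:R) n; rewrite pochS.
  have -> : x + 3%:R * n%:R + 2%:R + 1 = x + 1 + 3%:R * n%:R + 2%:R by ring.
  by move=> e; rewrite mulrC -e; ring.
have e2 : poch (x + 1 + n%:R) n.+1 * (x + n%:R) = poch (x + n%:R) n.+1 * (x + 2%:R * n%:R + 1).
  have := pochSl (x + n%:R) n.+1; rewrite pochS.
  have -> : x + n%:R + 1 = x + 1 + n%:R by ring.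
  by move=> e; rewrite mulrC -e -[n.+1]addn1 natrD; ring.
set a := poch (_ + 2%:R) n in e1 *; set b := poch (_ + 2%:R) n in e1 *.
set c := poch _ n.+1 in e2 *; set d := poch _ n.+1 in e2 *.
set e := poch _ n.+1 in n3 *.
transitivity ((a * (x + 3%:R * n%:R + 2%:R)) * (c * (x + n%:R)) *
   (rhs_prod (x + 1) n * half_prod x n * poch x n) * 2%:R ^+ n / (half_prod x n * e)).
  by field; rewrite n1 n2 n3.
rewrite e1 e2 IH; by field; rewrite n2 n3.
Qed.

(** Over a common denominator the numerators differ by (x + 4n + 6)(x + n + 2) - (2n + 3)(x + 2n +
    4), which factors as x (x + 3n + 5). This factorisation is what allows a product to satisfy the
    three-term relation. *)
Lemma rhs_factor_sub x n : 0 <= x ->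
  rhs_factor (x + 1) n.+2 - rhs_factor (x + 4%:R) n.+1
  = poch (x + 3%:R * n%:R + 6%:R) n * poch (x + n%:R + 4%:R) n * (x * (x + 3%:R * n%:R + 5%:R))
    * 2%:R ^+ n / (half_prod (x + 4%:R) n * poch n.+1%:R n.+1 * (2%:R * n%:R + 3%:R)).
Proof.
move=> hx; rewrite !rhs_factorS poch_nnS half_prodSl.
have h2 : 0 <= n%:R :> rat by rewrite ler0n.
have -> : x + 1 + 3%:R = x + 4%:R by ring.
have n1 : half_prod (x + 4%:R) n != 0 by rewrite gt_eqF // half_prod_gt0 //; lra.
have n3 : poch n.+1%:R n.+1 != 0 by rewrite gt_eqF // poch_nn_gt0.
have -> : x + 1 + 3%:R * n.+1%:R + 2%:R = x + 3%:R * n%:R + 6%:R by rewrite -[n.+1]addn1 natrD; ring.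
have -> : x + 4%:R + 3%:R * n%:R + 2%:R = x + 3%:R * n%:R + 6%:R by ring.
have -> : x + 1 + n.+1%:R = x + n%:R + 2%:R by rewrite -[n.+1]addn1 natrD; ring.
have -> : x + 4%:R + n%:R = x + n%:R + 4%:R by ring.
rewrite (pochS (x + 3%:R * n%:R + 6%:R) n) (pochS (x + n%:R + 4%:R) n).
rewrite (pochSl _ n.+1) (pochSl (x + n%:R + 2%:R + 1) n).
have -> : x + n%:R + 2%:R + 1 + 1 = x + n%:R + 4%:R by ring.
rewrite exprS; field.
rewrite n1 n3 /=; apply/andP; split; apply: lt0r_neq0; lra.
Qed.

Lemma rhs_prod_at0 n : rhs_prod 0 n.+1 = 0.
Proof.
rewrite /rhs_prod big_ltn // /rhs_factor add0r subrr poch0 mul1r.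
by rewrite pochS poch0 addr0 mulr0 !mul0r.
Qed.

Lemma rhs_prod_bilinear x n : 0 <= x ->
  rhs_prod (x + 1) n.+1 * rhs_prod (x + 4%:R) n.+1
  = rhs_prod (x + 4%:R) n * rhs_prod (x + 1) n.+2 - rhs_prod (x + 5%:R) n * rhs_prod x n.+2.
Proof.
move=> hx; rewrite (rhs_prodS _ n.+1) (rhs_prodS (x + 4%:R)) (rhs_prodS x n.+1).
suff e : rhs_prod (x + 1) n.+1 * rhs_prod (x + 4%:R) n * (rhs_factor (x + 1) n.+2 - rhs_factor (x + 4%:R) n.+1)
   = rhs_prod (x + 5%:R) n * (rhs_prod x n.+1 * rhs_factor x n.+2).
  by rewrite -e; ring.
rewrite rhs_factor_sub //.
have h2 : 0 <= n%:R :> rat by rewrite ler0n.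
(* At x = 0 both sides vanish; elsewhere [poch x n.+1] can be divided out of [rhs_prod_shift]. *)
have [->|x0] := eqVneq x 0.
  by rewrite rhs_prod_at0 !(mul0r, mulr0).
have {x0 hx} x0 : 0 < x by rewrite lt_def x0 hx.
have s1 := rhs_prod_shift n.+1 (ltW x0).
have x4 : 0 <= x + 4%:R by lra.
have := rhs_prod_shift n x4.
have -> : x + 4%:R + 1 = x + 5%:R by ring.
move=> s2.
have h4 : 0 < half_prod (x + 4%:R) n by apply: half_prod_gt0.
have p4 : 0 < poch (x + 4%:R) n by apply: poch_gt0; lra.
have h0 : 0 < half_prod x n.+1 by apply: half_prod_gt0; lra.
have p0 : 0 < poch x n.+1 by apply: poch_gt0.
have n3 := poch_nn_gt0 n.
move: s1 => /(canRL (mulfK (lt0r_neq0 p0))) /(canRL (mulfK (lt0r_neq0 h0))) ->.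
move: s2 => /(canRL (mulfK (lt0r_neq0 p4))) /(canRL (mulfK (lt0r_neq0 h4))) ->.
rewrite rhs_factorS poch_nnS.
have -> : x + 3%:R * n.+1%:R + 2%:R = x + 3%:R * n%:R + 5%:R by rewrite -[n.+1]addn1 natrD; ring.
rewrite (pochSl (_ + 5%:R)).
have -> : x + 3%:R * n%:R + 5%:R + 1 = x + 3%:R * n%:R + 6%:R by ring.
pose c4 := \prod_(i < n) (x + 4%:R * i%:R + 6%:R).
pose c2 := \prod_(i < n) (x + 2%:R * i%:R + 5%:R).
have e4 : \prod_(i < n.+1) (x + 4%:R * i%:R + 2%:R) = (x + 2%:R) * c4.
  rewrite big_ord_recl mulr0 addr0; congr (_ * _); apply: eq_bigr => i _.
  by rewrite lift0 -[i.+1]addn1 natrD; ring.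
have e2 : \prod_(i < n.+1) (x + 2%:R * i%:R + 1) * (x + 2%:R * n%:R + 3%:R) = (x + 1) * (x + 3%:R) * c2.
  transitivity (\prod_(i < n.+2) (x + 2%:R * i%:R + 1)).
    by rewrite [RHS]big_ord_recr /= -[n.+1]addn1 natrD; congr (_ * _); ring.
  rewrite big_ord_recl [X in _ * X]big_ord_recl mulrA; congr (_ * _ * _).
  - by rewrite mulr0 addr0.
  - by rewrite lift0 mulr1 -addrA.
  apply: eq_bigr => i _; rewrite !lift0 -[i.+2]addn2 natrD; ring.
(* Two ways of cutting the product of the 2n + 4 factors x, x + 1, ..., x + 2n + 3. *)
have e5 : poch x n.+1 * poch (x + n.+1%:R) n.+2 * (x + 2%:R * n%:R + 3%:R) =
    x * (x + 1) * (x + 2%:R) * (x + 3%:R) * poch (x + 4%:R) n * poch (x + n%:R + 4%:R) n.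
  transitivity (poch x (n.+1 + n.+3)).
    rewrite pochD (pochS _ n.+2) mulrA; congr (_ * _).
    by rewrite -[n.+2]addn2 -[n.+1]addn1 !natrD; ring.
  rewrite (_ : n.+1 + n.+3 = n.+4 + n)%N; last by lia.
  rewrite pochD 4!pochSl !mulrA; congr (_ * _ * _ * _ * poch _ _ * poch _ _); try ring.
rewrite big_split /= e4.
have -> : \prod_(i < n) ((x + 4%:R + 4%:R * i%:R + 2%:R) * (x + 4%:R + 2%:R * i%:R + 1)) = c4 * c2.
  by rewrite big_split /=; congr (_ * _); apply: eq_bigr => i _; ring.
have q0 : 0 < x + 2%:R * n%:R + 3%:R by lra.
move: e2 => /(canRL (mulfK (lt0r_neq0 q0))) ->.
have -> : poch (x + n.+1%:R) n.+2 = x * (x + 1) * (x + 2%:R) * (x + 3%:R) *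
    poch (x + 4%:R) n * poch (x + n%:R + 4%:R) n / (poch x n.+1 * (x + 2%:R * n%:R + 3%:R)).
  by rewrite -e5; field; rewrite (lt0r_neq0 q0) (lt0r_neq0 p0).
rewrite exprS; field.
rewrite (lt0r_neq0 q0) (lt0r_neq0 h4) (lt0r_neq0 p4) (lt0r_neq0 h0) (lt0r_neq0 p0) (lt0r_neq0 n3) /=.
by rewrite andbT; apply: lt0r_neq0; lra.
Qed.

Lemma tau_det_eq n a b a' b' : (n <= b.+1)%N -> (n <= b'.+1)%N -> (a + b' = a' + b)%N ->
  tau_det rat n a b = tau_det rat n a' b'.
Proof.
have Dd_add c d e : (n <= d.+1)%N -> tau_det rat n (c + e) (d + e) = tau_det rat n c d.
  by move=> h; elim: e => [|e IH]; rewrite ?addn0 // !addnS tau_det_SS ?IH //; lia.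
by move=> h h' e; rewrite -(Dd_add a b b') // -(Dd_add a' b' b) // e [(b + b')%N]addnC.
Qed.

Lemma tau_det1 a b : (b <= a)%N -> tau_det rat 1 a b = (a - b)%:R.
Proof.
move=> hab; rewrite /tau_det det_mx11 !mxE /= /tau_pol expr0 mul1r addn0 subn0.
rewrite -[LHS]mulr1n -coef_deriv -horner_coef0 !derivE !deriv_exp !derivE !hornerE /=.
by rewrite !hornerMn !hornerE !expr1n !mulr1 mul1r mulNrn natrB.
Qed.

Lemma tau_detE n a b : (b <= a)%N -> (n <= b.+1)%N -> tau_det rat n a b = rhs_prod (a - b)%:R n.
Proof.
elim/ltn_ind: n a b => -[|[|n]] IH a b hab hn.
- by rewrite rhs_prod0 /tau_det det_mx00.
- rewrite tau_det1 // rhs_prodS rhs_prod0 mul1r rhs_factorS /half_prod big_ord0 !pochS !poch0.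
  by rewrite !(mul1r, addr0, mulr1, divr1).
(* Raising [b] to [c] with [a - b] fixed keeps every exponent in the Pluecker relation
   untruncated. *)
pose c := (b + n).+4.
have hc : (n.+3 < c)%N by rewrite /c; lia.
suff H M : tau_det rat n.+2 (c + M) c = rhs_prod M%:R n.+2.
  by rewrite -H; apply: tau_det_eq; rewrite /c; lia.
elim: M => [|M IHM]; first by rewrite addn0 tau_det_diag0 rhs_prod_at0.
have := @tau_det_plucker rat n (c + M) c (ltnW hc).
have D k a' b' d : (k < n.+2)%N -> (a' = b' + d)%N -> (k <= b'.+1)%N -> tau_det rat k a' b' = rhs_prod d%:R k.
  by move=> hk -> hb'; rewrite IH ?addKn // leq_addr.
rewrite (D n.+1 _ c.-1 M.+1) ?(D n.+1 _ c.-2 M.+4) ?(D n _ c.-2 M.+4) ?(D n _ c.-1.-2 (M + 5)%N); try lia.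
rewrite IHM (@tau_det_eq n.+2 _ c.-1 (c + M.+1) c); try lia.
have M0 : 0 <= M%:R :> rat by rewrite ler0n.
have := rhs_prod_bilinear n M0.
rewrite natr1 -!natrD addn4 => -> /(canRL (subrK _)); rewrite subrK.
(* The coefficient of the unknown determinant is [rhs_prod (M + 4) n], which is positive. *)
by move=> /mulfI ->; rewrite // lt0r_neq0 // rhs_prod_gt0 // ltr0n.
Qed.

(** * Alternating sums *)

Definition vdm (R : comNzRingType) n (t : 'I_n -> R) : R :=
  \prod_(j < n) \prod_(i < n | (i < j)%N) (t j - t i).

Definition alt (R : comNzRingType) n (Q : ('I_n -> R) -> R) (t : 'I_n -> R) : R :=
  \sum_(s : 'S_n) (-1) ^+ s * Q (t \o s).

(** * Alternants at nodes that collapse to the origin *)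

Section Newton.
Variable K : comNzRingType.

(** Repeated division by the linear factors of the nodes gives the Newton coefficients without
    inverting any difference of nodes. At 0 all nodes collapse to 0 and the Newton form becomes the
    Taylor form, whence the values [(a k).[0]]. *)
Lemma newton_interpolation n (t : nat -> {poly K}) (Q : {poly {poly K}}) :
  (forall i, (i < n)%N -> (t i).[0] = 0) ->
  exists a : nat -> {poly K},
    (forall k, (k < n)%N -> (a k).[0] = (map_poly (horner_eval 0) Q)`_k) /\
    (forall j, (j < n)%N -> Q.[t j] = \sum_(k < n) a k * \prod_(i < k) (t j - t i)).
Proof.
elim: n t Q => [|n IH] t Q t0; first by exists (fun=> 0).
have /factor_theorem [Q' eQ] : root (Q - (Q.[t 0%N])%:P) (t 0%N).
  by rewrite rootE !hornerE subrr.
have {}eQ : Q = (Q.[t 0%N])%:P + Q' * ('X - (t 0%N)%:P) by rewrite -eQ addrC subrK.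
have t00 := t0 0%N isT.
have [|a [a0 ha]] := IH (fun i => t i.+1) Q'; first by move=> i hi; apply: t0.
exists (fun k => if k is k'.+1 then a k' else Q.[t 0%N]); split.
- have mQ : map_poly (horner_eval 0) Q
      = (Q.[t 0%N].[0])%:P + map_poly (horner_eval 0) Q' * 'X.
    rewrite [in LHS]eQ rmorphD rmorphM /= map_polyC rmorphB /= map_polyX map_polyC /=.
    by rewrite /horner_eval t00 subr0.
  by case=> [|k] hk; rewrite mQ coefD coefC coefMX /= ?addr0 ?add0r ?a0.
- case=> [|j] hj; rewrite big_ord_recl big_ord0 mulr1.
    by rewrite big1 ?addr0 // => i _; rewrite lift0 big_ord_recl subrr mul0r mulr0.
  rewrite {1}eQ !hornerE ha //; congr (_ + _); rewrite mulr_suml.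
  apply: eq_bigr => k _; rewrite lift0 big_ord_recl -mulrA; congr (_ * _).
  by rewrite mulrC.
Qed.

(** The matrix is that of the Newton coefficients times a triangular one, whose diagonal product is
    [vdm t]. *)
Lemma alternant_factor n (q : 'I_n -> {poly K}) (t : 'I_n -> {poly K}) :
  (forall i, (t i).[0] = 0) ->
  exists g, \det (\matrix_(i, j) (q i \Po t j)) = vdm t * g /\
    g.[0] = \det (\matrix_(i, k < n) (q i)`_k).
Proof.
move=> t0; pose u i := oapp t 0 (insub i).
have uE (i : 'I_n) : u i = t i by rewrite /u valK.
have u0 i : (i < n)%N -> (u i).[0] = 0 by move=> hi; rewrite -[i]/(val (Ordinal hi)) uE.
have [a ha] := fin_all_exists (fun i : 'I_n => newton_interpolation (map_poly polyC (q i)) u0).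
pose A := \matrix_(i, k < n) a i k.
pose N := \matrix_(k < n, j < n) \prod_(i < k) (u j - u i).
exists (\det A); split.
  have -> : (\matrix_(i, j) (q i \Po t j)) = A *m N.
    apply/matrixP => i j; rewrite !mxE.
    have [_ /(_ j (ltn_ord j))] := ha i; rewrite uE => e; rewrite [LHS]e.
    by apply: eq_bigr => k _; rewrite !mxE uE.
  rewrite det_mulmx mulrC; congr (_ * _).
  rewrite -det_tr det_trig; last first.
    apply/is_trig_mxP => i j hij; rewrite !mxE.
    by rewrite (bigD1 (Ordinal hij)) //= subrr mul0r.
  apply: eq_bigr => j _; rewrite !mxE.
  rewrite (big_ord_widen n (fun i => u j - u i) (ltnW (ltn_ord j))).
  by apply: eq_bigr => i _; rewrite !uE.
rewrite -[LHS]/(horner_eval 0 _) -det_map_mx; congr (\det _).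
apply/matrixP => i k; rewrite !mxE.
have [/(_ k (ltn_ord k)) h _] := ha i; rewrite [LHS]h.
by rewrite -map_poly_comp map_poly_id // => c _; rewrite /= /horner_eval hornerC.
Qed.

(* Closed under products and linear in [alt], this class reduces [alt_lead] to alternants. *)
Definition separated n (Q : ('I_n -> {poly K}) -> {poly K}) : Prop :=
  exists l : seq ('I_n -> {poly K}), forall t, Q t = \sum_(q <- l) \prod_i (q i \Po t i).

Lemma separated_prod_ord n (q : 'I_n -> {poly K}) : separated (fun t => \prod_i (q i \Po t i)).
Proof. by exists [:: q] => t; rewrite big_seq1. Qed.

Lemma separated_add n (Q Q' : ('I_n -> {poly K}) -> {poly K}) :
  separated Q -> separated Q' -> separated (fun t => Q t + Q' t).
Proof. by move=> [l h] [l' h']; exists (l ++ l') => t; rewrite big_cat h h'. Qed.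

Lemma separated_mul n (Q Q' : ('I_n -> {poly K}) -> {poly K}) :
  separated Q -> separated Q' -> separated (fun t => Q t * Q' t).
Proof.
move=> [l h] [l' h']; exists [seq (fun i => q i * q' i) | q <- l, q' <- l'] => t.
rewrite h h' big_distrlr big_allpairs_dep /=.
apply: eq_bigr => q _; apply: eq_bigr => q' _; rewrite -big_split /=.
by apply: eq_bigr => i _; rewrite rmorphM.
Qed.

Lemma separated_coord n (f : {poly K}) (i : 'I_n) : separated (fun t => f \Po t i).
Proof.
exists [:: fun j => if j == i then f else 1] => t.
rewrite big_seq1 (bigD1 i) //= eqxx big1 ?mulr1 // => j /negPf ->.
by rewrite rmorph1.
Qed.

Lemma separated_eq n (Q Q' : ('I_n -> {poly K}) -> {poly K}) :
  (forall t, Q t = Q' t) -> separated Q -> separated Q'.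
Proof. by move=> e [l h]; exists l => t; rewrite -e. Qed.

Lemma separated_bigprod n I (r : seq I) (P : pred I) (Q : I -> ('I_n -> {poly K}) -> {poly K}) :
  (forall i, P i -> separated (Q i)) -> separated (fun t => \prod_(i <- r | P i) Q i t).
Proof.
move=> h; elim: r => [|i r IH].
  apply: separated_eq (separated_prod_ord (fun=> 1)) => t.
  by rewrite big_nil big1 // => i _; rewrite rmorph1.
have [hi|hi] := boolP (P i).
  by apply: separated_eq (separated_mul (h i hi) IH) => t; rewrite big_cons hi.
by apply: separated_eq IH => t; rewrite big_cons (negPf hi).
Qed.

(** [L] is chosen before [t]: the value at the origin may be computed on any convenient curve. *)
Lemma alt_lead n (Q : ('I_n -> {poly K}) -> {poly K}) : separated Q ->
  exists L : K, forall t, (forall i, (t i).[0] = 0) ->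
    exists g, alt Q t = vdm t * g /\ g.[0] = L.
Proof.
case=> l hl; exists (\sum_(q <- l) \det (\matrix_(i, k < n) (q i)`_k)) => t t0.
have {hl} -> : alt Q t = \sum_(q <- l) \det (\matrix_(i, j) (q i \Po t j)).
  rewrite /alt; under eq_bigr => s _ do rewrite hl mulr_sumr.
  rewrite exchange_big /=; apply: eq_bigr => q _; apply: eq_bigr => s _.
  by congr (_ * _); apply: eq_bigr => i _; rewrite mxE.
elim: l => [|q l [g [hg g0]]].
  by exists 0; rewrite !big_nil mulr0 horner0.
have [h [hh h0]] := alternant_factor q t0.
by exists (h + g); rewrite !big_cons hg hh -mulrDr hornerD h0 g0.
Qed.

End Newton.

(** * Splitting off one index in functions, permutations and products over pairs *)

Definition ins n T (i : 'I_n.+1) (x : T) (f : 'I_n -> T) (j : 'I_n.+1) : T :=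
  oapp f x (unlift i j).

Lemma ins_id n T i (x : T) (f : 'I_n -> T) : ins i x f i = x.
Proof. by rewrite /ins unlift_none. Qed.

Lemma ins_lift n T i (x : T) (f : 'I_n -> T) j : ins i x f (lift i j) = f j.
Proof. by rewrite /ins liftK. Qed.

Lemma ffun_ins_bij n (T : finType) (i : 'I_n.+1) :
  bijective (fun p : T * {ffun 'I_n -> T} => [ffun j => ins i p.1 p.2 j]).
Proof.
exists (fun f : {ffun 'I_n.+1 -> T} => (f i, [ffun j => f (lift i j)])) => [[x f]|f] /=.
  congr (_, _); first by rewrite ffunE ins_id.
  by apply/ffunP => j; rewrite !ffunE ins_lift.
apply/ffunP => j; rewrite ffunE.
by case: (unliftP i j) => [k|] ->; rewrite ?ins_lift ?ins_id ?ffunE.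
Qed.

Lemma sum_ffun_ins (V : nmodType) n (T : finType) (i : 'I_n.+1) (P : pred {ffun 'I_n.+1 -> T}) (F : {ffun 'I_n.+1 -> T} -> V) :
  \sum_(f | P f) F f = \sum_(x : T) \sum_(g : {ffun 'I_n -> T} | P [ffun j => ins i x g j]) F [ffun j => ins i x g j].
Proof.
rewrite (reindex _ (onW_bij _ (ffun_ins_bij T i))) /= pair_big_dep /=.
by apply: eq_bigl => -[].
Qed.

Lemma lift_perm_bij n (i0 : 'I_n.+1) :
  bijective (fun p : 'I_n.+1 * 'S_n => lift_perm i0 p.1 p.2).
Proof.
apply: inj_card_bij => [[j s] [j' s'] /= e|].
  have ej : j = j' by rewrite -(lift_perm_id i0 j s) e lift_perm_id.
  subst j'; congr (_, _); apply/permP => k; apply: (@lift_inj _ j).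
  by rewrite -!(lift_perm_lift i0) e.
by rewrite card_prod card_ord !card_Sn factS.
Qed.

Lemma sum_perm_image (V : nmodType) n (i0 : 'I_n.+1) (F : 'S_n.+1 -> V) :
  \sum_s F s = \sum_j \sum_(s : 'S_n) F (lift_perm i0 j s).
Proof.
rewrite (reindex _ (onW_bij _ (lift_perm_bij i0))) /= pair_big /=.
by apply: eq_bigl => -[].
Qed.

Lemma sum_perm_preimage (V : nmodType) n (j0 : 'I_n.+1) (F : 'S_n.+1 -> V) :
  \sum_s F s = \sum_i \sum_(s : 'S_n) F (lift_perm i j0 s).
Proof.
rewrite (reindex_inj invg_inj) /= (sum_perm_image j0); apply: eq_bigr => i _.
rewrite (reindex_inj invg_inj) /=; apply: eq_bigr => s _.
by rewrite lift_permV invgK.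
Qed.

Lemma big_lift (T : Type) (r0 : T) (op : Monoid.com_law r0) n (r : 'I_n.+1)
    (P : pred 'I_n.+1) (F : 'I_n.+1 -> T) :
  \big[op/r0]_(i | P i) F i =
  op (if P r then F r else r0) (\big[op/r0]_(i | P (lift r i)) F (lift r i)).
Proof.
rewrite big_mkcond (bigD1 r) //=; congr (op _ _).
rewrite (reindex_omap (lift r) (unlift r)) => [|i]; last first.
  by case: (unliftP r i) => [j|] -> //; rewrite ?liftK ?eqxx.
rewrite [RHS]big_mkcond [LHS]big_mkcond; apply: eq_bigr => i _.
by rewrite liftK eqxx andbT eq_sym neq_lift.
Qed.

Section Alt.
Variable R : comNzRingType.

(* In the coordinate [t = (1 - x) / (1 + x)] this is the monomial [x ^+ k] homogenised in degree [m]. *)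
Definition bernstein m k (t : R) := (1 - t) ^+ k * (1 + t) ^+ (m - k).
(** Up to -2 and two Bernstein factors, this is what the four decorations of an entry contribute
    when it serves as an end of both adjacent intervals; see [local_sum_both]. *)
Definition pair_factor (a b : R) := 1 + a - b + a * b.
Definition pair_prod n (t : 'I_n -> R) := \prod_(j < n) \prod_(i < n | (i < j)%N) pair_factor (t i) (t j).

Lemma lift_lt n (r : 'I_n.+1) (i j : 'I_n) : (lift r i < lift r j)%N = (i < j)%N.
Proof. by rewrite /= /bump; lia. Qed.

Lemma lift_lt_id n (r : 'I_n.+1) (i : 'I_n) : (lift r i < r)%N = (i < r)%N.
Proof. by rewrite /= /bump; lia. Qed.

Lemma id_lt_lift n (r : 'I_n.+1) (i : 'I_n) : (r < lift r i)%N = (r <= i)%N.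
Proof. by rewrite /= /bump; lia. Qed.

Lemma prod_pairs_lift n (r : 'I_n.+1) (F : 'I_n.+1 -> 'I_n.+1 -> R) :
  \prod_(j < n.+1) \prod_(i < n.+1 | (i < j)%N) F i j =
  (\prod_(i < n) if (i < r)%N then F (lift r i) r else F r (lift r i)) *
  \prod_(j < n) \prod_(i < n | (i < j)%N) F (lift r i) (lift r j).
Proof.
rewrite (big_lift _ r) /=. rewrite (big_lift _ r) /= ltnn /= mul1r.
under [X in _ * X = _]eq_bigr => j _ do rewrite (big_lift _ r) id_lt_lift.
rewrite big_split /= mulrA; congr (_ * _).
  rewrite [X in X * _]big_mkcond -big_split /=; apply: eq_bigr => i _.
  by rewrite lift_lt_id ltnNge; case: leqP; rewrite ?mulr1 ?mul1r.
by apply: eq_bigr => j _; apply: eq_bigl => i; rewrite lift_lt.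
Qed.

Lemma vdm_lift n (r : 'I_n.+1) (t : 'I_n.+1 -> R) :
  vdm t = (-1) ^+ r * (\prod_(i < n) (t (lift r i) - t r)) * vdm (t \o lift r).
Proof.
rewrite /vdm (prod_pairs_lift r (fun i j => t j - t i)) /=; congr (_ * _).
have -> : (-1) ^+ r = \prod_(i < n) (if (i < r)%N then -1 else 1) :> R.
  rewrite -big_mkcond -(big_ord_widen _ (fun=> -1) (_ : r <= n)%N) ?prodr_const ?card_ord //.
  by rewrite -ltnS ltn_ord.
rewrite -big_split /=; apply: eq_bigr => i _.
by case: ltnP => _; rewrite ?mul1r // mulN1r opprB.
Qed.

Lemma eq_alt n (Q Q' : ('I_n -> R) -> R) t : (forall s : 'S_n, Q (t \o s) = Q' (t \o s)) -> alt Q t = alt Q' t.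
Proof. by move=> h; apply: eq_bigr => s _; rewrite h. Qed.

Lemma alt_sum n I (r : seq I) (P : pred I) (Q : I -> ('I_n -> R) -> R) t :
  alt (fun t => \sum_(i <- r | P i) Q i t) t = \sum_(i <- r | P i) alt (Q i) t.
Proof.
rewrite /alt exchange_big /=; apply: eq_bigr => s _; by rewrite mulr_sumr.
Qed.

Lemma alt_mul_sym n (c : R) (Q Q' : ('I_n -> R) -> R) t :
  (forall s : 'S_n, Q (t \o s) = c * Q' (t \o s)) -> alt Q t = c * alt Q' t.
Proof.
by move=> h; rewrite /alt mulr_sumr; apply: eq_bigr => s _; rewrite h mulrCA.
Qed.

Lemma prod_comp_perm n (f : R -> R) (t : 'I_n -> R) (s : 'S_n) :
  \prod_i f ((t \o s) i) = \prod_i f (t i).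
Proof. by rewrite [RHS](reindex_inj (@perm_inj _ s)). Qed.

(** Here the position [i0] is fixed and the variable in it varies; in [alt_preimage] the variable is
    fixed and its position varies. *)
Lemma alt_image n (i0 : 'I_n.+1) (Q : ('I_n.+1 -> R) -> R) (t : 'I_n.+1 -> R) :
  (forall u v, u =1 v -> Q u = Q v) ->
  alt Q t = \sum_(j < n.+1) (-1) ^+ (i0 + j) * alt (fun u => Q (ins i0 (t j) u)) (t \o lift j).
Proof.
move=> Qext; rewrite /alt (sum_perm_image i0); apply: eq_bigr => j _.
rewrite mulr_sumr; apply: eq_bigr => s _.
rewrite mulrA odd_lift_perm !signr_addb !signr_odd exprD; congr (_ * _).
apply: Qext => k /=; case: (unliftP i0 k) => [l|] ->.
  by rewrite lift_perm_lift ins_lift.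
by rewrite lift_perm_id ins_id.
Qed.

Lemma alt_preimage n (j0 : 'I_n.+1) (Q : ('I_n.+1 -> R) -> R) (t : 'I_n.+1 -> R) :
  (forall u v, u =1 v -> Q u = Q v) ->
  alt Q t = \sum_(i < n.+1) (-1) ^+ (i + j0) * alt (fun u => Q (ins i (t j0) u)) (t \o lift j0).
Proof.
move=> Qext; rewrite /alt (sum_perm_preimage j0); apply: eq_bigr => i _.
rewrite mulr_sumr; apply: eq_bigr => s _.
rewrite mulrA odd_lift_perm !signr_addb !signr_odd exprD; congr (_ * _).
apply: Qext => k /=; case: (unliftP i k) => [l|] ->.
  by rewrite lift_perm_lift ins_lift.
by rewrite lift_perm_id ins_id.
Qed.

End Alt.

(** * The bounded Littlewood identity *)

Definition strict n (k : 'I_n -> nat) : bool :=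
  [forall i : 'I_n, forall j : 'I_n, (i < j)%N ==> (k i < k j)%N].

Lemma strictP n (k : 'I_n -> nat) :
  reflect (forall i j : 'I_n, (i < j)%N -> (k i < k j)%N) (strict k).
Proof.
apply: (iffP forallP) => h i; first by move=> j; apply/implyP; move: j; apply/forallP/h.
by apply/forallP => j; apply/implyP/h.
Qed.

Definition vals n N (k : {ffun 'I_n -> 'I_N}) (i : 'I_n) : nat := k i.

Section StrictSum.
Variable R : comNzRingType.

Definition gt_term n m (k : 'I_n -> nat) (t : 'I_n -> R) : R :=
  (\prod_i bernstein m (k i) (t i)) * pair_prod t.

(** [N] only provides a finite type, so that the bound [M] can vary in an induction; entries are
    below [M], whence the degree [M.-1]. *)
Definition strict_sum N n M (t : 'I_n -> R) : R :=
  \sum_(k : {ffun 'I_n -> 'I_N} | strict (vals k) && [forall i, k i < M]%N) alt (gt_term M.-1 (vals k)) t.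

Lemma gt_term_ext n m (k k' : 'I_n -> nat) (t t' : 'I_n -> R) :
  k =1 k' -> t =1 t' -> gt_term m k t = gt_term m k' t'.
Proof.
move=> hk ht; congr (_ * _); first by apply: eq_bigr => i _; rewrite hk ht.
by apply: eq_bigr => j _; apply: eq_bigr => i _; rewrite !ht.
Qed.

Lemma bernstein_pred m k (x : R) : (k < m)%N -> bernstein m k x = (1 + x) * bernstein m.-1 k x.
Proof.
case: m => // m hk; rewrite /bernstein /= subSn // exprS; ring.
Qed.

Lemma gt_term_pred n m (k : 'I_n -> nat) (t : 'I_n -> R) : (forall i, k i < m)%N ->
  gt_term m k t = (\prod_i (1 + t i)) * gt_term m.-1 k t.
Proof.
move=> h; rewrite /gt_term [RHS]mulrA; congr (_ * _); rewrite -big_split /=.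
by apply: eq_bigr => i _; rewrite bernstein_pred.
Qed.

Lemma pair_prod_ins n (r : 'I_n.+1) x (u : 'I_n -> R) :
  pair_prod (ins r x u) = (\prod_(i < n) if (i < r)%N then pair_factor (u i) x else pair_factor x (u i)) * pair_prod u.
Proof.
rewrite /pair_prod (prod_pairs_lift r (fun i j => pair_factor (ins r x u i) (ins r x u j))); congr (_ * _).
  by apply: eq_bigr => i _; rewrite ins_id ins_lift.
by apply: eq_bigr => j _; apply: eq_bigr => i _; rewrite !ins_lift.
Qed.

Lemma prod_ins n (r : 'I_n.+1) (F : 'I_n.+1 -> R) :
  \prod_i F i = F r * \prod_(i < n) F (lift r i).
Proof. by rewrite (big_lift _ r). Qed.

Lemma strict_ins_max n N x (g : {ffun 'I_n -> 'I_N}) :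
  strict (vals [ffun j => ins ord_max x g j]) = strict (vals g) && [forall i, g i < x]%N.
Proof.
apply/strictP/andP => [h|[/strictP hg /forallP hx] i j].
  split.
    apply/strictP => i j hij; have := h (lift ord_max i) (lift ord_max j).
    by rewrite /vals !ffunE !ins_lift lift_lt; apply.
  apply/forallP => i; have := h (lift ord_max i) ord_max.
  by rewrite /vals !ffunE ins_lift ins_id lift_lt_id; apply.
rewrite /vals !ffunE; case: (unliftP ord_max i) => [i'|] ->; case: (unliftP ord_max j) => [j'|] ->.
- by rewrite lift_lt !ins_lift; apply: hg.
- by rewrite ins_lift ins_id.
- by rewrite id_lt_lift leqNgt ltn_ord.
- by rewrite ltnn.
Qed.

(** Split by the largest entry. If it is below [M], lowering the degree frees a factor 1 + t_i per
    variable. If it is [M], [alt_image] singles out the variable [t r] that carries it, with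
    Bernstein factor (1 - t_r)^M. *)
Lemma strict_sum_rec N n M (t : 'I_n.+1 -> R) : (M < N)%N ->
  strict_sum N M.+1 t = (\prod_i (1 + t i)) * strict_sum N M t
   + \sum_(r < n.+1) (-1) ^+ (n + r) * (1 - t r) ^+ M
       * (\prod_(j < n) (pair_factor (t (lift r j)) (t r) * (1 + t (lift r j)))) * strict_sum N M (t \o lift r).
Proof.
move=> hM; rewrite /strict_sum (bigID (fun k : {ffun 'I_n.+1 -> 'I_N} => (k ord_max < M)%N)) /=; congr (_ + _).
  rewrite mulr_sumr; apply: eq_big => [k|k /andP[/andP[/strictP hk _] hm]].
    apply/idP/idP => [/andP[/andP[hs _] hm]|/andP[hs /forallP h]]; last first.
      by rewrite hs h andbT; apply/forallP => i; rewrite ltnW // ltnS h.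
    rewrite hs; apply/forallP => i; have [->//|hi] := eqVneq i ord_max.
    apply: ltn_trans hm; apply: (strictP _ hs i ord_max).
    have := ltn_ord i; rewrite ltnS leq_eqVlt => /orP[/eqP e|//].
    by case/eqP: hi; apply: val_inj.
  apply: alt_mul_sym => s; rewrite gt_term_pred.
    by rewrite (prod_comp_perm (fun x => 1 + x)).
  move=> i; have [->//|hi] := eqVneq i ord_max.
  apply: ltn_trans hm; apply: (hk i ord_max).
  have := ltn_ord i; rewrite ltnS leq_eqVlt => /orP[/eqP e|//].
  by case/eqP: hi; apply: val_inj.
pose xM := Ordinal hM.
rewrite (sum_ffun_ins ord_max) (bigD1 xM) //= [X in _ + X]big1 ?addr0; last first.
  move=> x hx; rewrite big_pred0 // => g; apply/negP => /andP[/andP[_ /forallP /(_ ord_max)]].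
  rewrite ffunE ins_id => h1; rewrite -leqNgt => h2; case/eqP: hx.
  by apply: val_inj => /=; lia.
have hP (g : {ffun 'I_n -> 'I_N}) :
    [&& strict (vals [ffun j => ins ord_max xM g j]) && [forall i, [ffun j => ins ord_max xM g j] i < M.+1]%N
      & ~~ ([ffun j => ins ord_max xM g j] ord_max < M)%N]
    = strict (vals g) && [forall i, g i < M]%N.
  rewrite strict_ins_max ffunE ins_id ltnn andbT.
  apply/andP/idP => [[]//|/andP[hs /forallP h]]; rewrite hs; split; first exact/forallP.
  apply/forallP => i; rewrite ffunE; case: (unliftP ord_max i) => [i'|] ->.
    by rewrite ins_lift ltnW // ltnS h.
  by rewrite ins_id.
rewrite (eq_bigl _ _ hP).
under eq_bigr => g hg.
  rewrite (alt_image ord_max); last first.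
    by move=> u v huv; apply: gt_term_ext.
  over.
rewrite exchange_big /=; apply: eq_bigr => r _.
rewrite mulr_sumr; apply: eq_bigr => g /andP[_ /forallP hg].
rewrite -!mulrA; congr (_ * _); rewrite mulrA; apply: alt_mul_sym => s.
set u := _ \o _.
rewrite /gt_term (prod_ins ord_max) pair_prod_ins.
have -> : vals [ffun j => ins ord_max xM g j] ord_max = M by rewrite /vals ffunE ins_id.
rewrite !ins_id.
have -> : \prod_(i < n) bernstein M (vals [ffun j => ins ord_max xM g j] (lift ord_max i))
      (ins ord_max (t r) u (lift ord_max i))
    = (\prod_(i < n) (1 + u i)) * \prod_(i < n) bernstein M.-1 (vals g i) (u i).
  rewrite -big_split; apply: eq_bigr => i _.
  by rewrite /vals ffunE !ins_lift bernstein_pred.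
rewrite {1}/bernstein subnn expr0 mulr1.
have -> : \prod_(i < n) (if (i < @ord_max n)%N then pair_factor (u i) (t r) else pair_factor (t r) (u i))
    = \prod_(i < n) pair_factor (u i) (t r) by apply: eq_bigr => i _; rewrite ltn_ord.
rewrite !big_split /= /u (prod_comp_perm (fun x => 1 + x)) (prod_comp_perm (fun x => pair_factor x (t r))) /=.
by ring.
Qed.
End StrictSum.

Lemma size_sub_monic (R : idomainType) (p q : {poly R}) n :
  p \is monic -> q \is monic -> size p = n.+1 -> size q = n.+1 -> (size (p - q)%R <= n)%N.
Proof.
move=> /monicP mp /monicP mq sp sq; apply/leq_sizeP => j; rewrite leq_eqVlt => /orP[/eqP <-|hj].
  by move: mp mq; rewrite !lead_coefE sp sq /= coefB => -> ->; rewrite subrr.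
by rewrite coefB !nth_default ?subrr ?sp ?sq.
Qed.

(** * Partial fractions and the sum over sign changes *)

Section Lagrange.
Variables (F : fieldType) (I : finType) (E : pred I) (u v : I -> F) (c : F).
Hypothesis u_inj : forall i j, E i -> E j -> i != j -> u i != u j.
Hypothesis u_neq : forall i, E i -> u i != c.

(* partial fractions of [prod (X - v i) / ((X - c) * prod (X - u i))], evaluated at infinity *)
Lemma sum_lagrange :
  1 - \prod_(i | E i) ((c - v i) / (c - u i)) =
  \sum_(r | E r) (u r - v r) / (u r - c) * \prod_(j | E j && (j != r)) ((u r - v j) / (u r - u j)).
Proof.
pose P (w : I -> F) := \prod_(i | E i) ('X - (w i)%:P).
pose N r := \prod_(j | E j) (u r - v j).
pose D r := \prod_(j | E j && (j != r)) (u r - u j).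
pose L := \sum_(r | E r) (N r / D r) *: \prod_(j | E j && (j != r)) ('X - (u j)%:P).
have D0 r : E r -> D r != 0.
  move=> hr; apply/prodf_neq0 => j /andP[hj hjr].
  by rewrite subr_eq0 u_inj // eq_sym.
have sP (Q : pred I) (w : I -> F) : size (\prod_(i | Q i) ('X - (w i)%:P)) = #|Q|.+1.
  by rewrite -big_filter size_prod_XsubC size_filter -sum1_count sum1_card.
have sL : (size L <= #|E|)%N.
  apply: (leq_trans (size_sum _ _ _)); apply/bigmax_leqP => r hr.
  apply: leq_trans (size_scale_leq _ _) _.
  rewrite (sP (fun j => E j && (j != r)) u) -[leqRHS](_ : #|[pred x | E x]| = _) //.
  by rewrite (cardD1x hr) add1n.
have rootG r : E r -> root (P v - P u - L) (u r).
  move=> hr; rewrite rootE !hornerE.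
  have -> : (P v).[u r] = N r by rewrite horner_prod; apply: eq_bigr => j _; rewrite !hornerE.
  have -> : (P u).[u r] = 0 by rewrite horner_prod (bigD1 r) //= !hornerE subrr mul0r.
  rewrite horner_sum (bigD1 r) //= [\sum_(i | E i && (i != r)) _]big1 ?addr0; last first.
    move=> s /andP[hs hsr]; rewrite hornerZ horner_prod (bigD1 r) /=; last by rewrite hr eq_sym.
    by rewrite hornerXsubC subrr mul0r mulr0.
  rewrite hornerZ horner_prod subr0.
  have -> : \prod_(j | E j && (j != r)) ('X - (u j)%:P).[u r] = D r.
    by apply: eq_bigr => j _; rewrite !hornerE.
  by rewrite divfK ?D0 // subrr.
have G0 : P v - P u - L = 0.
  apply/eqP/negPn/negP => G0.
  have ra : all (root (P v - P u - L)) [seq u i | i <- enum E].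
    by apply/allP => x /mapP[r]; rewrite mem_enum => hr ->; apply: rootG.
  have ru : uniq [seq u i | i <- enum E].
    rewrite map_inj_in_uniq ?enum_uniq // => i j; rewrite !mem_enum => hi hj e.
    by apply/eqP/negPn/negP => hij; case/eqP: (u_inj hi hj hij).
  have := max_poly_roots G0 ra ru.
  rewrite size_map -cardE ltnNge => /negP; apply.
  apply: (leq_trans (size_polyD _ _)); rewrite size_polyN geq_max sL andbT.
  by apply: size_sub_monic; rewrite ?sP //; apply: monic_prod => ? _; apply: monicXsubC.
have := congr1 (fun p => p.[c]) G0; rewrite !hornerE /= => /eqP.
have Pc w : (P w).[c] = \prod_(i | E i) (c - w i).
  by rewrite horner_prod; apply: eq_bigr => j _; rewrite !hornerE.
have Pu0 : \prod_(i | E i) (c - u i) != 0.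
  by apply/prodf_neq0 => j hj; rewrite subr_eq0 eq_sym u_neq.
rewrite subr_eq0 !Pc prodf_div => /eqP e.
apply: (mulIf Pu0); rewrite mulrBl mul1r divfK // -opprB e horner_sum -sumrN mulr_suml.
apply: eq_bigr => r hr; rewrite hornerZ horner_prod prodf_div -/(D r).
have -> : \prod_(j | E j && (j != r)) ('X - (u j)%:P).[c] = \prod_(j | E j && (j != r)) (c - u j).
  by apply: eq_bigr => j _; rewrite !hornerE.
rewrite /N (bigD1 r) //= [X in _ = _ * X](bigD1 r) //=.
have h1 := D0 r hr; have h2 := u_neq hr.
field; rewrite h1 subr_eq0 h2 //.
Qed.
End Lagrange.

Definition tau_fun (R : comNzRingType) n M l (x : R) : R :=
  x ^+ l * (1 + x) ^+ (M + l) * (1 - x) ^+ (n.-1 - l).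

Section SignSum.
Variable F : fieldType.

Definition sym_factor (a b : F) := 1 + a + b - a * b.

(** By [det_tau_fun] this is a Vandermonde-type determinant in [ucoord], divided by the product of
    the [2 * s i] and by the Vandermonde product of the squares, which change at most by a sign when
    some [s i] do. *)
Definition sign_term n M (s : 'I_n -> F) : F :=
  \prod_i ((1 + s i) ^+ M / (2 * s i)) *
  \prod_(j < n) \prod_(i < n | (i < j)%N) (sym_factor (s i) (s j) / (s i + s j)).

Definition flip n (e : {ffun 'I_n -> bool}) (t : 'I_n -> F) (i : 'I_n) : F :=
  if e i then - t i else t i.

Definition sign_sum n M (t : 'I_n -> F) : F :=
  \sum_(e : {ffun 'I_n -> bool}) sign_term M (flip e t).

Definition generic n (t : 'I_n -> F) : Prop :=
  [/\ (2 : F) != 0,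
      forall i, [/\ t i != 0, 1 + t i != 0, 1 - t i != 0 & 1 + t i ^+ 2 != 0],
      forall i j, i != j -> t i + t j != 0 /\ t i - t j != 0 &
      forall i j, [/\ sym_factor (t i) (t j) != 0, sym_factor (t i) (- t j) != 0, sym_factor (- t i) (t j) != 0
        & sym_factor (- t i) (- t j) != 0]].

Lemma generic_flip n (t : 'I_n -> F) e : generic t -> generic (flip e t).
Proof.
case=> h2 h1 hd hs; split=> //.
- by move=> i; have [? ? ? ?] := h1 i; rewrite /flip; case: (e i); rewrite ?oppr_eq0 ?opprK ?sqrrN; split.
- move=> i j hij; have [? ?] := hd _ _ hij; rewrite /flip.
  case: (e i); case: (e j); rewrite ?opprK; split => //.
  + by rewrite -opprD oppr_eq0.
  + by rewrite addrC subr_eq0 eq_sym -subr_eq0.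
  + by rewrite addrC subr_eq0 eq_sym -subr_eq0.
  + by rewrite -opprD oppr_eq0.
- by move=> i j; have [? ? ? ?] := hs i j; rewrite /flip; case: (e i); case: (e j); rewrite ?opprK; split.
Qed.

Lemma generic_lift n (r : 'I_n.+1) (t : 'I_n.+1 -> F) : generic t -> generic (t \o lift r).
Proof.
case=> h2 h1 hd hs; split=> // [i|i j hij|i j] /=; try exact: h1; try exact: hs.
by apply: hd; rewrite (inj_eq (@lift_inj _ r)).
Qed.

Definition ucoord (s : F) := s * (1 + s) / (1 - s).

Lemma ucoord_sub a b : 1 - a != 0 -> 1 - b != 0 ->
  ucoord b - ucoord a = (b - a) * sym_factor a b / ((1 - a) * (1 - b)).
Proof. by move=> ha hb; rewrite /ucoord /sym_factor; field; rewrite ha hb. Qed.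

Lemma ucoord_inj n (s : 'I_n -> F) i j : generic s -> i != j -> ucoord (s i) != ucoord (s j).
Proof.
case=> h2 h1 hd hs hij.
have [_ _ hi _] := h1 i; have [_ _ hj _] := h1 j; have [_ hij'] := hd _ _ hij; have [hss _ _ _] := hs j i.
by rewrite -subr_eq0 ucoord_sub // !mulf_neq0 // invr_eq0 mulf_neq0.
Qed.

(* The identity behind the recursion for [sign_sum]: the terms of [strict_sum_rec] with a marked sign
   are the residues of a rational function of [u]. *)
Lemma sum_flip n (t : 'I_n -> F) (e : {ffun 'I_n -> bool}) (s := flip e t) : generic t ->
  \prod_i (1 + s i) - \prod_i (1 + t i) =
  \sum_(r | e r) 2 * s r * \prod_(j | j != r)
     (pair_factor (t j) (t r) * (1 + t j) * (s j + s r) / ((t j - t r) * sym_factor (s j) (s r))).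
Proof.
move=> gt; have gs : generic s := generic_flip e gt.
have [h2 h1 hd hs] := gs.
have s1 i : 1 + s i != 0 by have [] := h1 i.
have s2 i : 1 - s i != 0 by have [] := h1 i.
have u1 i : ucoord (s i) - -1 = (1 + s i ^+ 2) / (1 - s i) by rewrite /ucoord; field.
have uc i : e i -> ucoord (s i) != -1.
  by move=> _; rewrite -subr_eq0 u1 mulf_neq0 ?invr_eq0 //; have [] := h1 i.
have ui i j : e i -> e j -> i != j -> ucoord (s i) != ucoord (s j) by move=> _ _; apply: ucoord_inj.
have /(congr1 (fun x => \prod_i (1 + s i) * x)) := sum_lagrange (fun i => ucoord (- s i)) ui uc.
rewrite mulrBr mulr1 mulr_sumr.
(* The reason for evaluating at c = -1: 1 + u = (1 + s^2) / (1 - s) has an even numerator, so each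
   quotient is (1 - s) / (1 + s) and turns 1 + s i into 1 + t i. *)
have -> : \prod_i (1 + s i) * \prod_(i | e i) ((-1 - ucoord (- s i)) / (-1 - ucoord (s i))) = \prod_i (1 + t i).
  rewrite [X in _ * X]big_mkcond -big_split; apply: eq_bigr => i _ /=.
  have [_ _ _ h] := h1 i.
  case ei: (e i); last by rewrite mulr1 /s /flip ei.
  have -> : t i = - s i by rewrite /s /flip ei opprK.
  rewrite /ucoord; field.
  have -> : -1 * (1 - s i) - s i * (1 + s i) = - (1 + s i ^+ 2) by ring.
  by rewrite oppr_eq0 h s2 opprK s1.
move=> ->; apply: eq_bigr => r er.
rewrite (bigD1 r) //= mulrACA; congr (_ * _).
  rewrite u1 /ucoord; have [_ _ _ h] := h1 r.
  field.
  by rewrite opprK h s1 s2.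
rewrite [X in _ * X = _](eq_bigl (fun j => (j != r) && e j)) => [|j]; last by rewrite andbC.
rewrite big_mkcondr -big_split; apply: eq_bigr => j hjr /=.
have tr : t r = - s r by rewrite /s /flip er opprK.
have [hp hm] := hd _ _ hjr; have [hss _ _ _] := hs j r.
case ej: (e j); last first.
  have -> : t j = s j by rewrite /s /flip ej.
  by rewrite tr /pair_factor; move: hp hss; rewrite /sym_factor => hp hss; field; rewrite hss opprK hp.
have -> : t j = - s j by rewrite /s /flip ej opprK.
rewrite tr ucoord_sub // /ucoord /pair_factor; move: hss hm; rewrite /sym_factor => hss hm.
have c1 : 1 - - s j != 0 by rewrite opprK.
  have c2 : - s j - - s r != 0 by rewrite -opprD oppr_eq0.
  have c3 : s r * (1 + s r) * (1 - s j) + - (s j * (1 + s j)) * (1 - s r) != 0.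
    rewrite [X in X != 0](_ : _ = (- s j - - s r) * (1 + s j + s r - s j * s r)); last ring.
    by rewrite mulf_neq0.
  by field; rewrite hss c1 c2 c3 !s2.
by rewrite opprK.
Qed.

Lemma prod_lift_neq n (r : 'I_n.+1) (f : 'I_n.+1 -> F) :
  \prod_(j | j != r) f j = \prod_(j < n) f (lift r j).
Proof.
rewrite (big_lift _ r) eqxx /= mul1r; apply: eq_bigl => j.
by rewrite eq_sym neq_lift.
Qed.

Lemma sign_term_ext n M (s s' : 'I_n -> F) : s =1 s' -> sign_term M s = sign_term M s'.
Proof.
move=> h; congr (_ * _); first by apply: eq_bigr => i _; rewrite h.
by apply: eq_bigr => j _; apply: eq_bigr => i _; rewrite !h.
Qed.

Lemma sign_term_S n M (s : 'I_n -> F) : sign_term M.+1 s = \prod_i (1 + s i) * sign_term M s.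
Proof.
rewrite /sign_term [RHS]mulrA; congr (_ * _); rewrite -big_split; apply: eq_bigr => i _ /=.
by rewrite exprS mulrA.
Qed.

Lemma sign_term_lift n M (r : 'I_n.+1) (s : 'I_n.+1 -> F) :
  sign_term M s = (1 + s r) ^+ M / (2 * s r)
    * (\prod_(j | j != r) (sym_factor (s j) (s r) / (s j + s r))) * sign_term M (s \o lift r).
Proof.
rewrite /sign_term (prod_ins r) (prod_pairs_lift r (fun i j => sym_factor (s i) (s j) / (s i + s j))).
rewrite prod_lift_neq.
have -> : \prod_(j < n) (if (j < r)%N then sym_factor (s (lift r j)) (s r) / (s (lift r j) + s r)
      else sym_factor (s r) (s (lift r j)) / (s r + s (lift r j)))
    = \prod_(j < n) (sym_factor (s (lift r j)) (s r) / (s (lift r j) + s r)).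
  apply: eq_bigr => j _; case: ifP => // _.
  by rewrite /sym_factor [s r + _]addrC; congr (_ / _); ring.
by rewrite mulrACA.
Qed.

Lemma sign_sum_rec n M (t : 'I_n.+1 -> F) : generic t ->
  sign_sum M.+1 t = (\prod_i (1 + t i)) * sign_sum M t
   + \sum_(r < n.+1) (1 - t r) ^+ M
     * (\prod_(j < n) (pair_factor (t (lift r j)) (t r) * (1 + t (lift r j)) / (t (lift r j) - t r)))
     * sign_sum M (t \o lift r).
Proof.
move=> gt; rewrite addrC; apply/eqP; rewrite -subr_eq; apply/eqP.
rewrite /sign_sum mulr_sumr -sumrB.
pose X r (e : {ffun 'I_n.+1 -> bool}) := (1 - t r) ^+ M
     * (\prod_(j | j != r) (pair_factor (t j) (t r) * (1 + t j) / (t j - t r)))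
     * sign_term M (flip e t \o lift r).
transitivity (\sum_(e : {ffun 'I_n.+1 -> bool}) \sum_(r | e r) X r e).
  apply: eq_bigr => e _; rewrite sign_term_S -mulrBl (sum_flip e gt) mulr_suml.
  apply: eq_bigr => r er; rewrite (sign_term_lift M r) /X.
  have [h2 h1 hd hs] := generic_flip e gt.
  have sr : flip e t r = - t r by rewrite /flip er.
  have [sr0 _ _ _] := h1 r.
  rewrite !mulrA; congr (_ * _).
  have -> : 1 - t r = 1 + flip e t r by rewrite sr.
  pose A := \prod_(j | j != r) (pair_factor (t j) (t r) * (1 + t j) * (flip e t j + flip e t r)
     / ((t j - t r) * sym_factor (flip e t j) (flip e t r))).
  pose B := \prod_(j | j != r) (sym_factor (flip e t j) (flip e t r) / (flip e t j + flip e t r)).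
  have -> : \prod_(j | j != r) (pair_factor (t j) (t r) * (1 + t j) / (t j - t r)) = A * B.
    rewrite /A /B -big_split; apply: eq_bigr => j hjr /=.
    have [hp hm] := hd _ _ hjr; have [hss _ _ _] := hs j r.
    have hm' : t j - t r != 0 by have [_ _ hd' _] := gt; have [] := hd' _ _ hjr.
    by field; rewrite hss hp hm'.
  rewrite -/A -/B.
  by field; rewrite sr0 h2.
(* The marked index r is always flipped, so what remains is a sum over the signs of the other
   variables. *)
rewrite (exchange_big_dep predT) //=; apply: eq_bigr => r _.
rewrite (sum_ffun_ins r) big_bool /=.
have -> : \sum_(g : {ffun 'I_n -> bool} | [ffun j => ins r false g j] r) X r [ffun j => ins r false g j] = 0.
  by rewrite big_pred0 // => g; rewrite ffunE ins_id.
rewrite addr0 mulr_sumr; apply: eq_big => [g|g _]; first by rewrite ffunE ins_id.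
rewrite /X prod_lift_neq; congr (_ * _ * _).
apply: sign_term_ext => i /=; rewrite /flip ffunE ins_lift //.
Qed.

Lemma prod_pairs_mul n (f : 'I_n -> F) :
  \prod_(j < n) \prod_(i < n | (i < j)%N) (f i * f j) = (\prod_i f i) ^+ n.-1.
Proof.
case: n f => [|n] f; first by rewrite !big_ord0.
elim: n f => [|n IH] f; first by rewrite expr0 big_ord1 big_pred0 // => -[[]].
rewrite (prod_pairs_lift ord_max (fun i j => f i * f j)) (IH (f \o lift ord_max)) /=.
rewrite [in RHS](prod_ins ord_max) exprMn.
have -> : \prod_(i < n.+1) (if (i < @ord_max n.+1)%N then f (lift ord_max i) * f ord_max
    else f ord_max * f (lift ord_max i)) = \prod_(i < n.+1) (f ord_max * f (lift ord_max i)).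
  by apply: eq_bigr => i _; case: ifP => // _; rewrite mulrC.
by rewrite big_split /= prodr_const card_ord -mulrA -exprS.
Qed.

Lemma det_tau_fun n M (s : 'I_n -> F) : generic s ->
  \det (\matrix_(i < n, l < n) tau_fun n M l (s i)) =
  sign_term M s * \prod_i (2 * s i) * \prod_(j < n) \prod_(i < n | (i < j)%N) (s j ^+ 2 - s i ^+ 2).
Proof.
move=> gs; have [h2 h1 hd hs] := gs.
have s2 i : 1 - s i != 0 by have [] := h1 i.
pose d : 'rV[F]_n := \row_i ((1 - s i) ^+ n.-1 * (1 + s i) ^+ M).
pose u : 'rV[F]_n := \row_i ucoord (s i).
have -> : \matrix_(i < n, l < n) tau_fun n M l (s i) = diag_mx d *m (Vandermonde n u)^T.
  apply/matrixP => i l; rewrite mul_diag_mx !mxE /tau_fun /ucoord.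
  have hl : (l <= n.-1)%N by have := ltn_ord l; lia.
  rewrite -[in RHS](subnK hl) !exprD !exprMn exprVn.
  have h := expf_neq0 l (s2 i).
  by field.
rewrite det_mulmx det_tr det_Vandermonde det_diag.
under eq_bigr => i _ do rewrite mxE.
rewrite (exchange_big_dep predT) //=.
have -> : \prod_(j < n) \prod_(i < n | (i < j)%N) (u 0 j - u 0 i) =
    (\prod_(j < n) \prod_(i < n | (i < j)%N) (s j ^+ 2 - s i ^+ 2)) *
    (\prod_(j < n) \prod_(i < n | (i < j)%N) (sym_factor (s i) (s j) / (s i + s j))) *
    (\prod_(j < n) \prod_(i < n | (i < j)%N) ((1 - s i)^-1 * (1 - s j)^-1)).
  rewrite -!big_split; apply: eq_bigr => j _; rewrite -!big_split; apply: eq_bigr => i hij /=.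
  have nij : i != j by apply: contraTneq hij => ->; rewrite ltnn.
  have [hp _] := hd _ _ nij.
  by rewrite !mxE ucoord_sub //; field; rewrite hp !s2.
rewrite (prod_pairs_mul (fun i => (1 - s i)^-1)) /sign_term.
have e1 : \prod_i ((1 - s i) ^+ n.-1 * (1 + s i) ^+ M) * (\prod_i (1 - s i)^-1) ^+ n.-1
   = \prod_i ((1 + s i) ^+ M / (2 * s i)) * \prod_i (2 * s i).
  rewrite -prodrXl -!big_split; apply: eq_bigr => i _ /=.
  have [si0 _ _ _] := h1 i; have h := expf_neq0 n.-1 (s2 i).
  by rewrite exprVn; field; rewrite h si0 h2.
by rewrite mulrCA e1 [RHS]mulrC -!mulrA; congr (_ * _); rewrite mulrCA.
Qed.

(** Multilinearity in the rows gives a signed sum over [flip e t]; the sign is absorbed by the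
    product of the [2 * flip e t i]. *)
Lemma det_flip n M (t : 'I_n -> F) : generic t ->
  \det (\matrix_(i < n, l < n) (tau_fun n M l (t i) - tau_fun n M l (- t i))) =
  \prod_i (2 * t i) * (\prod_(j < n) \prod_(i < n | (i < j)%N) (t j ^+ 2 - t i ^+ 2)) * sign_sum M t.
Proof.
move=> gt; pose G (e : {ffun 'I_n -> bool}) := \matrix_(i < n, l < n) tau_fun n M l (flip e t i).
transitivity (\sum_(e : {ffun 'I_n -> bool}) (\prod_i (-1) ^+ e i) * \det (G e)).
  transitivity (\sum_(s : 'S_n) \sum_(e : {ffun 'I_n -> bool})
     (-1) ^+ s * \prod_i ((-1) ^+ e i * tau_fun n M (s i) (if e i then - t i else t i))).
    apply: eq_bigr => s _; rewrite -mulr_sumr; congr (_ * _).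
    rewrite -(bigA_distr_bigA (fun i (b : bool) => (-1) ^+ b * tau_fun n M (s i) (if b then - t i else t i))).
    by apply: eq_bigr => i _; rewrite mxE big_bool /= expr0 expr1 mulN1r mul1r addrC.
  rewrite exchange_big; apply: eq_bigr => e _; rewrite /determinant mulr_sumr.
  apply: eq_bigr => s _; rewrite big_split /= mulrCA; congr (_ * (_ * _)).
  by apply: eq_bigr => i _; rewrite mxE.
rewrite /sign_sum mulr_sumr; apply: eq_bigr => e _; rewrite det_tau_fun; last exact: generic_flip.
have e1 : \prod_i (-1) ^+ e i * \prod_i (2 * flip e t i) = \prod_i (2 * t i).
  rewrite -big_split; apply: eq_bigr => i _; rewrite /flip /=.
  by case: (e i); rewrite ?expr0 ?expr1 ?mul1r // mulN1r mulrN opprK.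
have -> : \prod_(j < n) \prod_(i < n | (i < j)%N) (flip e t j ^+ 2 - flip e t i ^+ 2)
   = \prod_(j < n) \prod_(i < n | (i < j)%N) (t j ^+ 2 - t i ^+ 2).
  apply: eq_bigr => j _; apply: eq_bigr => i _; rewrite /flip.
  by case: (e i); case: (e j); rewrite ?sqrrN.
by rewrite -e1 mulrA mulrCA -[sign_term _ _ * _ * _]mulrC; ring.
Qed.

Lemma sign_sum_0 n (t : 'I_n.+1 -> F) : generic t -> sign_sum 0 t = 0.
Proof.
move=> gt; have := det_flip 0 gt; have [h2 h1 hd hs] := gt.
have -> : \det (\matrix_(i < n.+1, l < n.+1) (tau_fun n.+1 0 l (t i) - tau_fun n.+1 0 l (- t i))) = 0.
  apply/eqP; rewrite -det_tr; apply/det0P.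
  (* With binomial weights the functions add up to (1 - x + x (1 + x))^n = (1 + x^2)^n, which is
     even, so the columns of odd parts are dependent. *)
  exists (\row_l ('C(n, l)%:R)).
    by apply/eqP => /rowP /(_ ord0); rewrite !mxE bin0 => /eqP; rewrite oner_eq0.
  apply/rowP => i; rewrite !mxE.
  have key x : \sum_(l < n.+1) 'C(n, l)%:R * tau_fun n.+1 0 l x = (1 + x ^+ 2) ^+ n.
    have -> : 1 + x ^+ 2 = (1 - x) + x * (1 + x) by ring.
    rewrite exprDn; apply: eq_bigr => l _.
    by rewrite /tau_fun add0n exprMn -mulr_natl; ring.
  under eq_bigr => l _ do rewrite !mxE mulrBr.
  by rewrite sumrB !key sqrrN subrr.
move/esym/eqP; rewrite !mulf_eq0 => /orP[/orP[]|/eqP //].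
  by move/prodf_eq0 => [i _]; have [h _ _ _] := h1 i; rewrite mulf_eq0 (negPf h2) (negPf h).
move/prodf_eq0 => [j _] /prodf_eq0[i hij].
have nij : i != j by apply: contraTneq hij => ->; rewrite ltnn.
have [hp hm] := hd _ _ nij.
have hm' : t j - t i != 0 by rewrite -opprB oppr_eq0.
by rewrite subr_sqr mulf_eq0 (negPf hm') addrC (negPf hp).
Qed.

(** This order of the differences matches the sign (-1)^(n + r) in [strict_sum_rec]. *)
Definition vdm_rev n (t : 'I_n -> F) := \prod_(j < n) \prod_(i < n | (i < j)%N) (t i - t j).

Lemma vdm_rev_lift n (r : 'I_n.+1) (t : 'I_n.+1 -> F) :
  vdm_rev t = (-1) ^+ (n + r) * (\prod_(i < n) (t (lift r i) - t r)) * vdm_rev (t \o lift r).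
Proof.
rewrite /vdm_rev (prod_pairs_lift r (fun i j => t i - t j)) /=; congr (_ * _).
have -> : (-1) ^+ (n + r) = \prod_(i < n) (if (i < r)%N then 1 else -1) :> F.
  rewrite exprD -[in (-1) ^+ n](card_ord n) -prodr_const.
  have hr : (r <= n)%N by rewrite -ltnS.
  have -> : (-1) ^+ r = \prod_(i < n) (if (i < r)%N then -1 else 1) :> F.
    rewrite -big_mkcond -(big_ord_widen _ (fun=> -1) hr) prodr_const card_ord //.
  rewrite -big_split; apply: eq_bigr => i _ /=.
  by case: ltnP => _; rewrite ?mulr1 // mulrNN mulr1.
rewrite -big_split /=; apply: eq_bigr => i _.
by case: ltnP => _; rewrite ?mul1r // mulN1r opprB.
Qed.

Lemma strict_sumE0 N M (t : 'I_0 -> F) : strict_sum N M t = vdm_rev t * sign_sum M t.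
Proof.
have -> : vdm_rev t = 1 by rewrite /vdm_rev big_ord0.
have -> : sign_sum M t = 1.
  rewrite /sign_sum (eq_bigr (fun=> 1)) => [|e _]; last by rewrite /sign_term !big_ord0 mulr1.
  by rewrite sumr_const card_ffun card_ord expn0.
rewrite /strict_sum (eq_bigr (fun=> 1)) => [|k _]; last first.
  rewrite /alt (eq_bigr (fun=> 1)) => [|s _]; first by rewrite sumr_const card_Sn.
  have -> : s = 1%g by apply/permP => -[].
  by rewrite odd_perm1 /gt_term /pair_prod !big_ord0 !mulr1.
rewrite (eq_bigl predT) => [|k].
  by rewrite sumr_const card_ffun !card_ord expn0 mul1r.
by apply/andP; split; [apply/strictP => -[] | apply/forallP => -[]].
Qed.

Lemma strict_sumE N n M (t : 'I_n -> F) : (M <= N)%N -> generic t -> strict_sum N M t = vdm_rev t * sign_sum M t.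
Proof.
elim: M n t => [|M IH] n t hM gt; last first.
  case: n t gt => [|n] t gt; first exact: strict_sumE0.
  rewrite strict_sum_rec // IH ?(ltnW hM) // sign_sum_rec // mulrDr mulrCA; congr (_ + _).
  rewrite mulr_sumr; apply: eq_bigr => r _.
  rewrite IH ?(ltnW hM) //; last exact: generic_lift.
  have [_ _ hd _] := gt.
  rewrite (vdm_rev_lift r) prodf_div big_split /=.
  have : \prod_(j < n) (t (lift r j) - t r) != 0.
    by apply/prodf_neq0 => j _; have [] := hd (lift r j) r; rewrite // eq_sym neq_lift.
  set A := \prod_(j < n) (t _ - _) => hA; set B := \prod_(j < n) pair_factor _ _; set C := \prod_(j < n) (1 + _).
  by field.
case: n t gt => [|n] t gt; first exact: strict_sumE0.
rewrite sign_sum_0 // mulr0 /strict_sum big_pred0 // => k.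
by apply/negP => /andP[_ /forallP /(_ ord0)]; rewrite ltn0.
Qed.

Lemma vdm_revE n (t : 'I_n -> F) : vdm_rev t = (-1) ^+ 'C(n, 2) * vdm t.
Proof.
rewrite -bin2_sum big_mkord expr_sum -big_split; apply: eq_bigr => j _ /=.
have -> : (-1) ^+ j = \prod_(i < n | (i < j)%N) (-1) :> F.
  by rewrite -(big_ord_widen _ (fun=> -1) (ltnW (ltn_ord j))) prodr_const card_ord.
by rewrite -big_split; apply: eq_bigr => i _ /=; rewrite mulN1r opprB.
Qed.

Lemma strict_sum_det N n M (t : 'I_n -> F) : (M <= N)%N -> generic t ->
  strict_sum N M t * (\prod_i (2 * t i) * \prod_(j < n) \prod_(i < n | (i < j)%N) (t i + t j)) =
  (-1) ^+ 'C(n, 2) * \det (\matrix_(i < n, l < n) (tau_fun n M l (t i) - tau_fun n M l (- t i))).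
Proof.
move=> hM gt; rewrite strict_sumE // det_flip // vdm_revE.
have -> : \prod_(j < n) \prod_(i < n | (i < j)%N) (t j ^+ 2 - t i ^+ 2)
   = vdm t * \prod_(j < n) \prod_(i < n | (i < j)%N) (t i + t j).
  rewrite -big_split; apply: eq_bigr => j _; rewrite -big_split; apply: eq_bigr => i _ /=.
  ring.
by ring.
Qed.
End SignSum.

(** * From the fraction field back to polynomials and their values at 0 *)

Section Morph.
Variables (R S : comNzRingType) (f : {rmorphism R -> S}).

Lemma rmorph_gt_term n m (k : 'I_n -> nat) (t : 'I_n -> R) :
  f (gt_term m k t) = gt_term m k (f \o t).
Proof.
rewrite /gt_term /pair_prod rmorphM !rmorph_prod; congr (_ * _).
  by apply: eq_bigr => i _; rewrite /bernstein rmorphM !rmorphXn rmorphB rmorphD rmorph1.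
apply: eq_bigr => j _; rewrite rmorph_prod; apply: eq_bigr => i _.
by rewrite /pair_factor /= !rmorphD rmorphN rmorphM rmorph1.
Qed.

Lemma rmorph_alt_gt_term n m (k : 'I_n -> nat) (t : 'I_n -> R) :
  f (alt (gt_term m k) t) = alt (gt_term m k) (f \o t).
Proof.
rewrite /alt rmorph_sum; apply: eq_bigr => s _.
by rewrite rmorphM rmorph_sign rmorph_gt_term.
Qed.

Lemma rmorph_tau_fun n M l (x : R) : f (tau_fun n M l x) = tau_fun n M l (f x).
Proof. by rewrite /tau_fun !rmorphM !rmorphXn rmorphB rmorphD rmorph1. Qed.
End Morph.

(* [L] is the value at the origin of the polynomial [alt Q / vdm]. *)
Definition lead (K : comNzRingType) n (Q : ('I_n -> {poly K}) -> {poly K}) (L : K) : Prop :=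
  forall t, (forall i, (t i).[0] = 0) -> exists g, alt Q t = vdm t * g /\ g.[0] = L.

(** Distinct positive slopes keep all sums and differences nonzero. *)
Definition pts n (i : 'I_n) : {poly rat} := i.+1%:R *: 'X.

Lemma pts0 n (i : 'I_n) : (pts i).[0] = 0.
Proof. by rewrite /pts hornerZ hornerX mulr0. Qed.

Lemma pts_neq0 n (i : 'I_n) : pts i != 0.
Proof. by rewrite /pts scaler_eq0 polyX_eq0 orbF pnatr_eq0. Qed.

Lemma pts_add n (i j : 'I_n) : pts i + pts j != 0.
Proof. by rewrite -scalerDl scaler_eq0 polyX_eq0 orbF -natrD pnatr_eq0. Qed.

Lemma pts_sub n (i j : 'I_n) : i != j -> pts i - pts j != 0.
Proof. by move=> hij; rewrite -scalerBl scaler_eq0 polyX_eq0 orbF subr_eq0 eqr_nat eqSS. Qed.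

Lemma vdm_pts_neq0 n : vdm (@pts n) != 0.
Proof.
apply/prodf_neq0 => j _; apply/prodf_neq0 => i hij; apply: pts_sub.
by apply: contraTneq hij => ->; rewrite ltnn.
Qed.

Lemma neq0_horner (p : {poly rat}) x : p.[x] != 0 -> p != 0.
Proof. by apply: contra_neq => ->; rewrite horner0. Qed.

Local Notation tof := (@tofrac {poly rat}).

Lemma generic_pts n : generic (fun i : 'I_n => tof (pts i)).
Proof.
have tf (p : {poly rat}) : p != 0 -> tof p != 0 by rewrite tofrac_eq0.
split.
- by rewrite -(rmorph_nat tof) tf // -polyC_natr polyC_eq0.
- move=> i; rewrite -(rmorph1 tof) -!rmorphXn -!rmorphB -!rmorphD.
  by split; apply/tf; rewrite ?pts_neq0 //; apply: (@neq0_horner _ 0); rewrite /pts !hornerE /= ?expr0n /= ?subr0 ?addr0.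
- move=> i j hij; rewrite -!rmorphB -!rmorphD; split; apply/tf; first exact: pts_add.
  exact: pts_sub.
- move=> i j; rewrite /sym_factor -(rmorph1 tof) -!rmorphN -!rmorphM -!rmorphD -!rmorphB.
  by split; apply/tf; apply: (@neq0_horner _ 0); rewrite /pts !hornerE ?oppr0 ?mulr0 ?subr0 ?addr0.
Qed.

Lemma horner_odd_part (K : comNzRingType) (p q : {poly K}) :
  (p \Po q) - (p \Po (- q)) = 2 * q * (odd_poly p \Po q ^+ 2).
Proof.
have e (r : {poly K}) : p \Po r = (even_poly p \Po r ^+ 2) + (odd_poly p \Po r ^+ 2) * r.
  rewrite -{1}(poly_even_odd p) comp_polyD comp_polyM comp_polyX -!comp_polyA.
  by rewrite comp_Xn_poly.
have e2 : (- q) ^+ 2 = q ^+ 2 by ring.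
rewrite (e q) (e (- q)) e2; ring.
Qed.

Lemma sum_lead n m (L : {ffun 'I_n -> 'I_m.+1} -> rat) :
  (forall k, strict (vals k) -> lead (gt_term m (vals k)) (L k)) ->
  \sum_(k : {ffun 'I_n -> 'I_m.+1} | strict (vals k)) L k
  = (-1) ^+ 'C(n, 2) * tau_det rat n m.+1 n.-1.
Proof.
move=> hL.
have [g [hg g0]] : exists g, strict_sum m.+1 m.+1 (@pts n) = vdm (@pts n) * g /\
   g.[0] = \sum_(k : {ffun 'I_n -> 'I_m.+1} | strict (vals k)) L k.
  have /fin_all_exists [g hg] (k : {ffun 'I_n -> 'I_m.+1}) :
      exists g, strict (vals k) -> alt (gt_term m (vals k)) (@pts n) = vdm (@pts n) * g /\ g.[0] = L k.
    have [hk|hk] := boolP (strict (vals k)); last by exists 0.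
    by have [g hg] := hL k hk _ (@pts0 n); exists g.
  exists (\sum_(k : {ffun 'I_n -> 'I_m.+1} | strict (vals k)) g k); split.
    rewrite mulr_sumr; apply: eq_big => [k|k /andP[hk _]].
      by rewrite (_ : [forall i, _]) ?andbT //; apply/forallP => i; apply: ltn_ord.
    by have [] := hg k hk.
  by rewrite horner_sum; apply: eq_bigr => k hk; have [] := hg k hk.
pose S := \prod_(j < n) \prod_(i < n | (i < j)%N) (pts i + pts j).
have H : strict_sum m.+1 m.+1 (@pts n) * (\prod_(i < n) (2 * pts i) * S) =
  (-1) ^+ 'C(n, 2) * \det (\matrix_(i < n, l < n) (tau_fun n m.+1 l (pts i) - tau_fun n m.+1 l (- pts i))).
  have := strict_sum_det (leqnn m.+1) (@generic_pts n).
  have -> : strict_sum m.+1 m.+1 (fun i : 'I_n => tof (pts i)) = tof (strict_sum m.+1 m.+1 (@pts n)).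
    by rewrite /strict_sum rmorph_sum; apply: eq_bigr => k _; rewrite rmorph_alt_gt_term.
  have -> : \prod_(i < n) (2 * tof (pts i)) * \prod_(j < n) \prod_(i < n | (i < j)%N) (tof (pts i) + tof (pts j))
     = tof (\prod_(i < n) (2 * pts i) * S).
    rewrite rmorphM !rmorph_prod; congr (_ * _).
      by apply: eq_bigr => i _; rewrite rmorphM rmorph_nat.
    by apply: eq_bigr => j _; rewrite rmorph_prod; apply: eq_bigr => i _; rewrite rmorphD.
  have -> : \matrix_(i < n, l < n) (tau_fun n m.+1 l (tof (pts i)) - tau_fun n m.+1 l (- tof (pts i)))
     = map_mx tof (\matrix_(i < n, l < n) (tau_fun n m.+1 l (pts i) - tau_fun n m.+1 l (- pts i))).
    by apply/matrixP => i l; rewrite !mxE rmorphB !rmorph_tau_fun rmorphN.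
  rewrite det_map_mx -(rmorph_sign tof) -!rmorphM => /eqP.
  by rewrite tofrac_eq => /eqP.
pose o (l : 'I_n) := odd_poly (tau_pol rat m.+1 n.-1 l).
have gcolE (l : 'I_n) (p : {poly rat}) : tau_fun n m.+1 l p = tau_pol rat m.+1 n.-1 l \Po p.
  rewrite /tau_pol !rmorphM /= !rmorphXn /= rmorphB rmorphD rmorph1 /= comp_polyX //.
have sq0 i : (@pts n i ^+ 2).[0] = 0 by rewrite horner_exp pts0 expr0n.
(* The odd parts form an alternant in the squares of the nodes. Its Vandermonde product is that of
   the nodes times [S], and at 0 it leaves the odd coefficients of [tau_pol]. *)
have [h [hh h0]] := alternant_factor o sq0.
have detE : \det (\matrix_(i < n, l < n) (tau_fun n m.+1 l (pts i) - tau_fun n m.+1 l (- pts i)))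
   = \prod_(i < n) (2 * pts i) * (vdm (@pts n) * S * h).
  have -> : vdm (@pts n) * S = vdm (fun i => @pts n i ^+ 2).
    rewrite /vdm -big_split; apply: eq_bigr => j _; rewrite -big_split; apply: eq_bigr => i _ /=.
    ring.
  rewrite -hh -[\det (\matrix_(i, j) (o i \Po _))]det_tr.
  have -> : \matrix_(i < n, l < n) (tau_fun n m.+1 l (pts i) - tau_fun n m.+1 l (- pts i))
      = diag_mx (\row_i (2 * @pts n i)) *m (\matrix_(l, i) (o l \Po @pts n i ^+ 2))^T.
    by apply/matrixP => i l; rewrite mul_diag_mx !mxE !gcolE horner_odd_part.
  by rewrite det_mulmx det_diag; congr (_ * _); apply: eq_bigr => i _; rewrite mxE.
have P0 : \prod_(i < n) (2 * pts i) != 0.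
  by apply/prodf_neq0 => i _; rewrite mulf_neq0 ?pts_neq0 // -polyC_natr polyC_eq0.
have S0 : S != 0.
  by apply/prodf_neq0 => j _; apply/prodf_neq0 => i _; apply: pts_add.
have V0 := vdm_pts_neq0 n.
have {H} : g = (-1) ^+ 'C(n, 2) * h.
  move: H; rewrite hg detE => H.
  apply: (mulfI (mulf_neq0 P0 (mulf_neq0 V0 S0))); rewrite -[LHS]mulrA -[RHS]mulrA.
  transitivity (vdm (@pts n) * g * (\prod_(i < n) (2 * pts i) * S)); first by ring.
  by rewrite H; ring.
move=> /(congr1 (fun p => p.[0])); rewrite g0 hornerM h0 => ->; congr (_ * _).
  by rewrite horner_exp !hornerE.
rewrite -det_tr /tau_det; congr (\det _); apply/matrixP => k l; rewrite !mxE /o.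
by rewrite coef_odd_poly.
Qed.

(** * Summation over one row *)

Section RowWeights.
Variable R : comNzRingType.

(* [x <= y] are consecutive entries of a row, [s] (resp. [t]) tells that [x] carries NE (resp. [y] carries NW),
   and [l] is the entry between them in the row above.  Summing over [l] amounts to summing over
   [x + s <= l <= y - t], where the range [x + 1 <= l <= x - 1] counts as minus the value at [x]:
   this is the special little triangle. *)
Definition interval_weight (x y : nat) (s t : bool) (l : nat) : R :=
  if [&& x <= l, l <= y, ((x == l) && s) ==> ((y == x) && t) & ((y == l) && t) ==> ((x == y) && s)]%N
  then (-1) ^+ [&& x == l, y == l, s & t] else 0.

Definition row_weight n (k : nat -> nat) (a : 'I_n -> nat) : R :=
  \sum_(d : {ffun 'I_n.+1 -> 'I_4}) (\prod_c (-1) ^+ isDouble (d c)) *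
     \prod_(i < n) interval_weight (k i) (k i.+1) (hasNE (d (widen_ord (leqnSn n) i))) (hasNW (d (lift ord0 i))) (a i).

(** Since -2 z = (1 - z) - (1 + z), each Bernstein term becomes a difference and the sum telescopes.
    For x = y the right-hand side also covers the empty range and the weight -1. *)
Lemma sum_interval_weight m (x y : nat) (s t : bool) (z : R) : (x <= y <= m)%N ->
  \sum_(l < m.+1) interval_weight x y s t l * bernstein m l z * (-2 * z) =
  bernstein m.+1 (y.+1 - t) z - bernstein m.+1 (x + s) z.
Proof.
move=> /andP[hxy hym].
have step l : (l <= m)%N -> bernstein m l z * (-2 * z) = bernstein m.+1 l.+1 z - bernstein m.+1 l z.
  by move=> hl; rewrite /bernstein subSS subSn // !exprS; ring.
have [exy|nxy] := eqVneq x y.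
  subst y; have hx : (x < m.+1)%N by [].
  rewrite (bigD1 (Ordinal hx)) //= big1 ?addr0 => [|l hl]; last first.
    rewrite /interval_weight; case: ifP => [/and3P[h1 h2 _]|]; last by rewrite !mul0r.
    by case/eqP: hl; apply: val_inj => /=; lia.
  rewrite -mulrA step // /interval_weight leqnn eqxx /=.
  case: s; case: t; rewrite /= ?expr0 ?expr1 ?mul0r ?mul1r ?mulN1r ?subn0 ?subn1 ?addn0 ?addn1 /= ?opprB ?subrr //.
have lxy : (x < y)%N by rewrite ltn_neqAle nxy.
have hab : (x + s <= y.+1 - t)%N by case: s; case: t; lia.
rewrite -(telescope_sumr (fun l => bernstein m.+1 l z) hab) big_geq_mkord.
have hm : (y.+1 - t <= m.+1)%N by lia.
rewrite (big_ord_widen_cond _ (fun l => true && (x + s <= l)%N) (fun l => bernstein m.+1 l.+1 z - bernstein m.+1 l z) hm).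
rewrite [RHS]big_mkcond; apply: eq_bigr => l _.
rewrite -mulrA step; last by rewrite -ltnS.
have -> : interval_weight x y s t l = ((x + s <= l) && (l < y.+1 - t))%N%:R.
  rewrite /interval_weight (eq_sym y x) (negPf nxy) /= !implybF.
  have -> : [&& x == l, y == l, s & t] = false.
    by apply/negP => /and4P[/eqP e1 /eqP e2 _ _]; case/eqP: nxy; rewrite e1 e2.
  rewrite expr0; case: ifP => h; [rewrite (_ : _ && _ = true) // | rewrite (_ : _ && _ = false) //].
    by case: s t h {hab hm} => -[]; lia.
  by apply/negP => h'; move/negP: h; apply; case: s t h' {hab hm} => -[]; lia.
by rewrite /=; case: ifP => _; rewrite ?mul1r ?mul0r.
Qed.

Lemma sum_decorations (f g : bool -> R) :
  \sum_(d : 'I_4) (-1) ^+ isDouble d * (f (hasNW d) * g (hasNE d)) =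
  f false * g false + f true * g false + f false * g true - f true * g true.
Proof.
rewrite !big_ord_recl big_ord0 /isDouble /hasNW /hasNE /=.
by rewrite !expr0 expr1; ring.
Qed.

Definition ord_ext n (y : 'I_n -> R) (j : nat) : R := oapp y 0 (insub j).
Lemma ord_extE n (y : 'I_n -> R) (j : 'I_n) : ord_ext y j = y j.
Proof. by rewrite /ord_ext valK. Qed.

Definition bool_ext n (B : {ffun 'I_n -> bool}) (j : nat) : bool := oapp B false (insub j).
Lemma bool_extE n (B : {ffun 'I_n -> bool}) (j : 'I_n) : bool_ext B j = B j.
Proof. by rewrite /bool_ext valK. Qed.

Section Local.
Variables (m n : nat) (k : nat -> nat) (B : {ffun 'I_n -> bool}) (y : 'I_n -> R).

(** Entry c is the upper end of interval c - 1 and the lower end of interval c. The value is 1 if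
    that interval is missing or contributes its other end. *)
Definition upper_end (c : nat) (b : bool) : R :=
  if (0 < c)%N && bool_ext B c.-1 then bernstein m.+1 ((k c).+1 - b) (ord_ext y c.-1) else 1.
Definition lower_end (c : nat) (b : bool) : R :=
  if (c < n)%N && ~~ bool_ext B c then - bernstein m.+1 (k c + b) (ord_ext y c) else 1.
Definition local_sum (c : nat) : R :=
  \sum_(d : 'I_4) (-1) ^+ isDouble d * (upper_end c (hasNW d) * lower_end c (hasNE d)).

Lemma local_sum_none c : ~~ ((0 < c)%N && bool_ext B c.-1) -> ~~ ((c < n)%N && ~~ bool_ext B c) -> local_sum c = 2.
Proof.
by move=> /negPf h1 /negPf h2; rewrite /local_sum sum_decorations /upper_end /lower_end h1 h2; ring.
Qed.

(** With the other end equal to 1, the two terms with NE cancel and twice the undecorated value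
    remains; [local_sum_upper] is symmetric. *)
Lemma local_sum_lower c : ~~ ((0 < c)%N && bool_ext B c.-1) -> (c < n)%N -> ~~ bool_ext B c ->
  local_sum c = - 2 * bernstein m.+1 (k c) (ord_ext y c).
Proof.
move=> /negPf h1 h2 h3; rewrite /local_sum sum_decorations /upper_end /lower_end h1 h2 h3 addn0 /=; ring.
Qed.

Lemma local_sum_upper c : (0 < c)%N -> bool_ext B c.-1 -> ~~ ((c < n)%N && ~~ bool_ext B c) ->
  local_sum c = 2 * bernstein m.+1 (k c).+1 (ord_ext y c.-1).
Proof.
move=> h1 h2 /negPf h3; rewrite /local_sum sum_decorations /upper_end /lower_end h1 h2 h3 subn0 /=; ring.
Qed.

Lemma local_sum_both c : (0 < c)%N -> bool_ext B c.-1 -> (c < n)%N -> ~~ bool_ext B c -> (k c <= m)%N ->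
  local_sum c = -2 * (bernstein m (k c) (ord_ext y c.-1) * bernstein m (k c) (ord_ext y c)) * pair_factor (ord_ext y c) (ord_ext y c.-1).
Proof.
move=> h1 h2 h3 h4 hk; rewrite /local_sum sum_decorations /upper_end /lower_end h1 h2 h3 h4 /= subn0 subn1 addn0 addn1 /=.
by rewrite /bernstein /pair_factor subSS subSn // !exprS; ring.
Qed.
End Local.

(* [B i] tells that the upper end of the [i]-th interval is chosen when the product is expanded;
   the sums over the decorations of the single entries then decouple. *)
Lemma sum_row_expand m n (k : nat -> nat) (y : 'I_n -> R) :
  \sum_(d : {ffun 'I_n.+1 -> 'I_4}) (\prod_c (-1) ^+ isDouble (d c)) *
     \prod_(i < n) (bernstein m.+1 ((k i.+1).+1 - hasNW (d (lift ord0 i))) (y i)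
                    - bernstein m.+1 (k i + hasNE (d (widen_ord (leqnSn n) i))) (y i)) =
  \sum_(B : {ffun 'I_n -> bool}) \prod_(c < n.+1) local_sum m k B y c.
Proof.
transitivity (\sum_(d : {ffun 'I_n.+1 -> 'I_4}) \sum_(B : {ffun 'I_n -> bool})
   \prod_(c < n.+1) ((-1) ^+ isDouble (d c) * (upper_end m k B y c (hasNW (d c)) * lower_end m k B y c (hasNE (d c))))).
  apply: eq_bigr => d _.
  pose G (i : 'I_n) (b : bool) : R := if b then bernstein m.+1 ((k i.+1).+1 - hasNW (d (lift ord0 i))) (y i)
     else - bernstein m.+1 (k i + hasNE (d (widen_ord (leqnSn n) i))) (y i).
  rewrite (eq_bigr (fun i => \sum_(b : bool) G i b)) => [|i _]; last by rewrite big_bool.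
  rewrite bigA_distr_bigA mulr_sumr; apply: eq_bigr => B _.
  rewrite !big_split /=; congr (_ * _).
  have zrn b : lower_end m k B y n b = 1 by rewrite /lower_end ltnn.
  rewrite big_ord_recl /= [\prod_(i < n.+1) lower_end _ _ _ _ _ _]big_ord_recr /= zrn mulr1 mul1r.
  rewrite -big_split; apply: eq_bigr => i _ /=.
  rewrite -[bump 0 i]/i.+1 /upper_end /lower_end /= !bool_extE !ord_extE ltn_ord /= /G.
  by case: (B i) => /=; rewrite ?mulr1 ?mul1r.
rewrite exchange_big; apply: eq_bigr => B _ /=.
by rewrite /local_sum bigA_distr_bigA.
Qed.

End RowWeights.

Section RowStep.
Variable R : idomainType.
Hypothesis two_neq0 : (2 : R) != 0.

Lemma alt_odd_sym n (Q : ('I_n -> R) -> R) (p : 'S_n) (t : 'I_n -> R) :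
  (forall u v, u =1 v -> Q u = Q v) -> odd_perm p -> (forall y, Q (y \o p) = Q y) ->
  alt Q t = 0.
Proof.
move=> Qext hp hQ; apply/eqP; rewrite -(inj_eq (mulfI two_neq0)) mulr0 mulr_natl mulr2n.
rewrite {1}/alt (reindex_inj (mulgI p)) -big_split big1 //= => s _.
rewrite (Qext _ ((t \o s) \o p)) => [|i]; last by rewrite /= permM.
by rewrite hQ odd_permM hp signr_addb expr1 mulN1r mulNr addNr.
Qed.

Lemma pair_prod_ext n (u v : 'I_n -> R) : u =1 v -> pair_prod u = pair_prod v.
Proof. by move=> h; apply: eq_bigr => j _; apply: eq_bigr => i _; rewrite !h. Qed.

Lemma local_sum_ext m n k (B : {ffun 'I_n -> bool}) (u v : 'I_n -> R) c : u =1 v -> local_sum m k B u c = local_sum m k B v c.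
Proof.
move=> h; have he j : ord_ext u j = ord_ext v j by rewrite /ord_ext; case: insub => //= i; rewrite h.
by rewrite /local_sum /upper_end /lower_end !he.
Qed.

Lemma pair_prod_swap n (i j : 'I_n) (y : 'I_n -> R) : j = i.+1 :> nat ->
  pair_prod (y \o tperm i j) * pair_factor (y i) (y j) = pair_prod y * pair_factor (y j) (y i).
Proof.
move=> hij; pose p := tperm i j.
have pairE (z : 'I_n -> R) : pair_prod z = \prod_(q : 'I_n * 'I_n | (q.1 < q.2)%N) pair_factor (z q.1) (z q.2).
  rewrite /pair_prod (exchange_big_dep predT) //= pair_big_dep /=.
  by apply: eq_bigl => -[].
have nij : (i == j) = false by apply/eqP => e; move: hij; rewrite e; lia.
have e1 : pair_prod y = pair_factor (y i) (y j) *
    \prod_(q : 'I_n * 'I_n | (q.1 < q.2)%N && (q != (i, j))) pair_factor (y q.1) (y q.2).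
  by rewrite pairE (bigD1 (i, j)) //= hij.
have e2 : pair_prod (y \o p) = pair_factor (y j) (y i) *
    \prod_(q : 'I_n * 'I_n | (p q.1 < p q.2)%N && (q != (j, i))) pair_factor (y q.1) (y q.2).
  rewrite pairE (reindex (fun q : 'I_n * 'I_n => (p q.1, p q.2))) /=; last first.
    by exists (fun q => (p q.1, p q.2)) => -[a b] _ /=; rewrite /p !tpermK.
  rewrite (eq_bigr (fun q : 'I_n * 'I_n => pair_factor (y q.1) (y q.2))) => [|[a b] _]; last by rewrite /= !tpermK.
  by rewrite (bigD1 (j, i)) //= /p tpermL tpermR hij.
rewrite e1 e2 -/p.
have -> : \prod_(q : 'I_n * 'I_n | (p q.1 < p q.2)%N && (q != (j, i))) pair_factor (y q.1) (y q.2)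
   = \prod_(q : 'I_n * 'I_n | (q.1 < q.2)%N && (q != (i, j))) pair_factor (y q.1) (y q.2).
  apply: eq_bigl => -[a b] /=; rewrite !xpair_eqE /p.
  by case: tpermP => [->|->|/eqP + /eqP +]; case: tpermP => [->|->|/eqP + /eqP +];
    rewrite -!val_eqE /= ?hij; lia.
ring.
Qed.

(* Exchanging [y i] and [y j] preserves the summand: the two choices at entry [j] produce the factor
   [pair_factor (y j) (y i)], which completes [pair_factor (y i) (y j)] to a symmetric product. *)
Lemma alt_row_term_eq0 m n (k : nat -> nat) (B : {ffun 'I_n -> bool}) (t : 'I_n -> R) (i j : 'I_n) :
  j = i.+1 :> nat -> B i -> ~~ B j -> (k j <= m)%N ->
  alt (fun y => (\prod_(c < n.+1) local_sum m k B y c) * pair_prod y) t = 0.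
Proof.
move=> hij Bi Bj hk; apply: (@alt_odd_sym _ _ (tperm i j)).
- move=> u v h; rewrite (pair_prod_ext h); congr (_ * _).
  by apply: eq_bigr => c _; apply: local_sum_ext.
- by rewrite odd_tperm; apply/eqP => e; move: hij; rewrite e; lia.
move=> y; pose p := tperm i j.
pose c0 : 'I_n.+1 := widen_ord (leqnSn n) j.
rewrite (bigD1 c0) //= [in RHS](bigD1 c0) //=.
have c0E z : local_sum m k B z j = -2 * (bernstein m (k j) (z i) * bernstein m (k j) (z j)) * pair_factor (z j) (z i).
  have ei : j.-1 = i by rewrite hij.
  by rewrite local_sum_both ?ei ?ord_extE ?bool_extE // hij.
rewrite !c0E /= tpermL tpermR.
have -> : \prod_(c < n.+1 | c != c0) local_sum m k B (y \o p) c = \prod_(c < n.+1 | c != c0) local_sum m k B y c.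
  apply: eq_bigr => c hc; apply: eq_bigr => d _; congr (_ * (_ * _)).
    rewrite /upper_end; case: ifP => // /andP[h0 h1]; congr (bernstein _ _ _).
    move: h1; rewrite /bool_ext /ord_ext; case: insubP => //= q _ eq Bq.
    rewrite tpermD //; apply/eqP => e; last by rewrite e Bq in Bj.
    case/eqP: hc; apply: val_inj => /=; rewrite hij e eq; lia.
  rewrite /lower_end; case: ifP => // /andP[h0 h1]; congr (- bernstein _ _ _).
  move: h1; rewrite /bool_ext /ord_ext insubT /= => Bq.
  rewrite tpermD //; apply/eqP => e; first by rewrite -e Bi in Bq.
  by case/eqP: hc; apply: val_inj => /=; rewrite e.
have := pair_prod_swap y hij; rewrite -/p => e.
set P := \prod_(c < n.+1 | _) _.
transitivity (-2 * (bernstein m (k j) (y j) * bernstein m (k j) (y i)) * P * (pair_prod (y \o p) * pair_factor (y i) (y j))); first by ring.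
by rewrite e; ring.
Qed.

End RowStep.

(** The choices that survive [alt_row_term_eq0]: no upper end is directly followed by a lower
    end. *)
Definition step_ffun n (r : nat) : {ffun 'I_n -> bool} := [ffun i : 'I_n => (r <= i)%N].

Lemma step_ffun_exists n (B : {ffun 'I_n -> bool}) :
  (forall i j : 'I_n, j = i.+1 :> nat -> B i -> B j) ->
  exists r : 'I_n.+1, B = step_ffun n r.
Proof.
move=> h; pose b j := (j < n)%N ==> bool_ext B j.
have exb : exists j, b j by exists n; rewrite /b ltnn.
case: (ex_minnP exb) => r br rmin.
have rn : (r < n.+1)%N by rewrite ltnS; apply: rmin; rewrite /b ltnn.
exists (Ordinal rn); apply/ffunP => i; rewrite ffunE /=; apply/idP/idP => [Bi|hri].
  by apply: rmin; rewrite /b bool_extE Bi implybT.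
have H d : (r + d < n)%N -> bool_ext B (r + d).
  elim: d => [|d IH] hd; first by move: br; rewrite /b addn0 in hd *; rewrite hd.
  have hd' : (r + d < n)%N by lia.
  have := IH hd'; rewrite -[(r + d)%N]/(val (Ordinal hd')) -[(r + d.+1)%N]/(val (Ordinal hd)) !bool_extE.
  by apply: h => /=; rewrite addnS.
have := H (i - r)%N; rewrite subnKC // bool_extE; apply; exact: ltn_ord.
Qed.

Lemma step_ffun_inj n (r r' : 'I_n.+1) : step_ffun n r = step_ffun n r' -> r = r'.
Proof.
move=> e; apply/val_inj/eqP; rewrite /= eqn_leq.
have H (a b : 'I_n.+1) : step_ffun n a = step_ffun n b -> (a <= b)%N.
  move=> /ffunP h; rewrite leqNgt; apply/negP => hba.
  have hb : (b < n)%N by have := ltn_ord a; lia.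
  by have := h (Ordinal hb); rewrite !ffunE /= leqnn leqNgt hba.
by rewrite !H.
Qed.

Lemma sum_step n (V : nmodType) (G : {ffun 'I_n -> bool} -> V) :
  (forall (B : {ffun 'I_n -> bool}) (i j : 'I_n), j = i.+1 :> nat -> B i -> ~~ B j -> G B = 0) ->
  \sum_B G B = \sum_(r < n.+1) G (step_ffun n r).
Proof.
move=> h; rewrite (bigID (mem [set step_ffun n r | r : 'I_n.+1])) /=.
rewrite [X in _ + X = _]big1 ?addr0 => [|B hB]; last first.
  have [/existsP[i /existsP[j /and3P[/eqP h1 h2 h3]]]|h0] :=
    boolP [exists i : 'I_n, [exists j : 'I_n, [&& j == i.+1 :> nat, B i & ~~ B j]]].
    exact: h h1 h2 h3.
  case/negP: hB; have [|r ->] := @step_ffun_exists n B; last exact: imset_f.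
  move=> i j e Bi; apply/negPn/negP => Bj; case/negP: h0.
  by apply/existsP; exists i; apply/existsP; exists j; rewrite e eqxx Bi Bj.
by rewrite big_imset //= => r r' _ _; apply: step_ffun_inj.
Qed.

(** Entry r is at no chosen end and gives 2; every other entry is at exactly one. *)
Lemma prod_local_sum_step (R : comNzRingType) m n (k : nat -> nat) (r : 'I_n.+1) (y : 'I_n -> R) :
  \prod_(c < n.+1) local_sum m k (step_ffun n r) y c =
  2 ^+ n.+1 * (-1) ^+ r * \prod_(i < n) (if (i < r)%N then bernstein m.+1 (k i) (y i) else bernstein m.+1 (k i.+1).+1 (y i)).
Proof.
have bE (i : 'I_n) : bool_ext (step_ffun n r) i = (r <= i)%N by rewrite bool_extE ffunE.
have bEn c : (c < n)%N -> bool_ext (step_ffun n r) c = (r <= c)%N.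
  by move=> hc; rewrite -[c]/(val (Ordinal hc)) bE.
rewrite (prod_ins r) local_sum_none; last 2 first.
- case: (nat_of_ord r) bEn (ltn_ord r) => //= r' bEn hr'.
  by rewrite bEn // ltnn.
- by case: ltnP => // hr; rewrite bEn // leqnn.
have sgnr : (-1) ^+ r = \prod_(i < n) (if (i < r)%N then -1 else 1) :> R.
  rewrite -big_mkcond -(big_ord_widen _ (fun=> -1) (_ : r <= n)%N) ?prodr_const ?card_ord //.
  by rewrite -ltnS ltn_ord.
rewrite exprS -!mulrA; congr (_ * _).
rewrite -[in 2 ^+ n](card_ord n) -prodr_const sgnr -!big_split; apply: eq_bigr => i _ /=.
case: ltnP => hi.
  have -> : bump r i = i by rewrite /bump leqNgt hi.
  rewrite local_sum_lower ?bE ?ord_extE -?ltnNge //; first by ring.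
  apply/negP => /andP[h0]; rewrite bEn; first by move=> h1; lia.
  by have := ltn_ord i; lia.
have -> : bump r i = i.+1 by rewrite /bump hi.
rewrite local_sum_upper //= ?ord_extE ?bE //; first by ring.
by apply/negP => /andP[h0]; rewrite bEn // => h1; lia.
Qed.

Section RowIdentity.
Variable R : idomainType.
Hypothesis two_neq0 : (2 : R) != 0.
Variables (m n : nat) (k : nat -> nat).
Hypothesis k_inc : forall i, (i < n)%N -> (k i <= k i.+1)%N.
Hypothesis k_le : forall i, (i <= n)%N -> (k i <= m)%N.

Lemma row_sum (y : 'I_n -> R) :
  \sum_(a : {ffun 'I_n -> 'I_m.+1}) row_weight R k (vals a) * (\prod_i bernstein m (a i) (y i)) * \prod_i (-2 * y i) =
  \sum_(d : {ffun 'I_n.+1 -> 'I_4}) (\prod_c (-1) ^+ isDouble (d c)) *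
     \prod_(i < n) (bernstein m.+1 ((k i.+1).+1 - hasNW (d (lift ord0 i))) (y i)
                    - bernstein m.+1 (k i + hasNE (d (widen_ord (leqnSn n) i))) (y i)).
Proof.
transitivity (\sum_(a : {ffun 'I_n -> 'I_m.+1}) \sum_(d : {ffun 'I_n.+1 -> 'I_4})
   (\prod_c (-1) ^+ isDouble (d c)) *
   ((\prod_(i < n) interval_weight R (k i) (k i.+1) (hasNE (d (widen_ord (leqnSn n) i))) (hasNW (d (lift ord0 i))) (a i))
     * (\prod_i bernstein m (a i) (y i) * \prod_i (-2 * y i)))).
  apply: eq_bigr => a _; rewrite -mulrA /row_weight mulr_suml.
  by apply: eq_bigr => d _; rewrite -mulrA.
rewrite exchange_big; apply: eq_bigr => d _ /=.
rewrite -mulr_sumr; congr (_ * _).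
transitivity (\prod_(i < n) \sum_(l < m.+1) interval_weight R (k i) (k i.+1) (hasNE (d (widen_ord (leqnSn n) i)))
    (hasNW (d (lift ord0 i))) l * bernstein m l (y i) * (-2 * y i)).
  rewrite bigA_distr_bigA; apply: eq_bigr => a _.
  by rewrite -!big_split; apply: eq_bigr => i _ /=; rewrite mulrA.
by apply: eq_bigr => i _; rewrite sum_interval_weight // k_inc //= k_le.
Qed.

Lemma row_identity (t : 'I_n -> R) :
  (\sum_(a : {ffun 'I_n -> 'I_m.+1}) row_weight R k (vals a) * alt (gt_term m (vals a)) t) * \prod_i (-2 * t i)
  = (-1) ^+ n * 2 ^+ n.+1 * alt (gt_term m (fun c : 'I_n.+1 => k c)) (ins ord_max 0 t).
Proof.
transitivity (alt (fun y => (\sum_(B : {ffun 'I_n -> bool}) \prod_(c < n.+1) local_sum m k B y c) * pair_prod y) t).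
  transitivity (\sum_(a : {ffun 'I_n -> 'I_m.+1}) \sum_(s : 'S_n)
      row_weight R k (vals a) * ((-1) ^+ s * gt_term m (vals a) (t \o s)) * \prod_i (-2 * t i)).
    by rewrite mulr_suml; apply: eq_bigr => a _; rewrite mulr_sumr mulr_suml.
  rewrite exchange_big; apply: eq_bigr => s _ /=.
  rewrite -sum_row_expand -row_sum mulr_suml mulr_sumr; apply: eq_bigr => a _.
  have -> : \prod_i (-2 * t i) = \prod_i (-2 * (t \o s) i) by rewrite (prod_comp_perm (fun x => -2 * x)).
  rewrite /gt_term /vals; move: (row_weight _ _ _) ((-1) ^+ s) (pair_prod _) (\prod_i (-2 * _)) (\prod_i bernstein _ _ _).
  by move=> A C D E G; ring.
transitivity (\sum_(B : {ffun 'I_n -> bool}) alt (fun y => (\prod_(c < n.+1) local_sum m k B y c) * pair_prod y) t).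
  by rewrite -alt_sum; apply: eq_alt => s; rewrite mulr_suml.
rewrite sum_step; last first.
  move=> B i j hij Bi Bj; apply: alt_row_term_eq0 hij Bi Bj _ => //.
  by apply: k_le; apply: ltnW.
(* With the variable 0 in position r, its Bernstein factor is 1, and its pair factors 1 + y i (for i
   < r) and 1 - y i raise the degree from m to m + 1, which reproduces the term of
   [step_ffun n r]. *)
rewrite (alt_preimage ord_max); last by move=> u v h; apply: gt_term_ext.
rewrite ins_id mulr_sumr; apply: eq_bigr => r _.
pose Q (y : 'I_n -> R) := gt_term m (fun c : 'I_n.+1 => k c) (ins r 0 y).
have QE y : (\prod_(c < n.+1) local_sum m k (step_ffun n r) y c) * pair_prod y
    = 2 ^+ n.+1 * (-1) ^+ r * Q y.
  rewrite prod_local_sum_step -!mulrA; congr (_ * (_ * _)).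
  rewrite /Q /gt_term (prod_ins r) pair_prod_ins ins_id.
  rewrite mulrA; congr (_ * _).
  have -> : bernstein m (k r) (0 : R) = 1 by rewrite /bernstein subr0 addr0 !expr1n mulr1.
  rewrite mul1r -big_split; apply: eq_bigr => i _ /=.
  rewrite ins_lift /pair_factor; case: ltnP => hi.
    have -> : bump r i = i by rewrite /bump leqNgt hi.
    rewrite /bernstein subSn ?exprS; first by ring.
    by apply: k_le; apply: ltnW.
  have -> : bump r i = i.+1 by rewrite /bump hi.
  by rewrite /bernstein subSS exprS; ring.
rewrite (alt_mul_sym (c := 2 ^+ n.+1 * (-1) ^+ r) (Q' := Q)) => [|s]; last by rewrite QE.
rewrite (eq_alt (Q := Q) (Q' := fun u => gt_term m (fun c : 'I_n.+1 => k c) (ins r 0 u))) //.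
have -> : alt (fun u => gt_term m (fun c : 'I_n.+1 => k c) (ins r 0 u)) (ins ord_max 0 t \o lift ord_max)
    = alt (fun u => gt_term m (fun c : 'I_n.+1 => k c) (ins r 0 u)) t.
  apply: eq_bigr => s _; congr (_ * _); apply: gt_term_ext => // c.
  rewrite /ins; case: unlift => //= i; exact: ins_lift.
rewrite exprD /=.
have [e|e] : (-1) ^+ n = 1 :> R \/ (-1) ^+ n = -1 :> R.
- by rewrite -signr_odd; case: odd; [right|left].
- by rewrite e; ring.
- by rewrite e; ring.
Qed.

End RowIdentity.

Lemma separated_gt_term (K : comNzRingType) n m (k : 'I_n -> nat) :
  separated (fun t : 'I_n -> {poly K} => gt_term m k t).
Proof.
apply: separated_mul.
  apply: separated_eq (separated_prod_ord (fun i => bernstein m (k i) 'X)) => t.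
  apply: eq_bigr => i _; rewrite /bernstein rmorphM !rmorphXn rmorphB rmorphD rmorph1 /= comp_polyX //.
apply: separated_bigprod => j _; apply: separated_bigprod => i _.
have sX (l : 'I_n) : separated (fun t : 'I_n -> {poly K} => t l).
  by apply: separated_eq (separated_coord 'X l) => t; rewrite comp_polyX.
have h1 : separated (fun t : 'I_n -> {poly K} => (1 + 'X) \Po t i).
  exact: separated_coord.
have h2 : separated (fun t : 'I_n -> {poly K} => (('X - 1) \Po t i) * t j).
  by apply: separated_mul => //; apply: separated_coord.
apply: separated_eq (separated_add h1 h2) => t.
by rewrite rmorphB rmorphD rmorph1 /= comp_polyX /pair_factor; ring.
Qed.

Lemma rmorph_row_weight (R S : comNzRingType) (f : {rmorphism R -> S}) n k (a : 'I_n -> nat) :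
  f (row_weight R k a) = row_weight S k a.
Proof.
rewrite /row_weight rmorph_sum; apply: eq_bigr => d _; rewrite rmorphM !rmorph_prod; congr (_ * _).
  by apply: eq_bigr => c _; rewrite rmorph_sign.
apply: eq_bigr => i _; rewrite /interval_weight; case: ifP => _; last by rewrite rmorph0.
by rewrite rmorph_sign.
Qed.

(** This confines the hypothesis of [lead_row_step] to weakly increasing rows, the only ones
    available in its induction. *)
Lemma row_weight_eq0 (R : comNzRingType) n k (a : 'I_n -> nat) (i j : 'I_n) :
  j = i.+1 :> nat -> (a j < a i)%N -> row_weight R k a = 0.
Proof.
move=> hij hji; rewrite /row_weight big1 // => d _.
rewrite [X in _ * X](_ : _ = 0) ?mulr0 //.
rewrite (bigD1 i) //= (bigD1 j) /=; last by apply/eqP => e; move: hij; rewrite e; lia.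
rewrite /interval_weight; case: ifP => [/and3P[h1 h2 _]|]; last by rewrite mul0r.
case: ifP => [/and3P[h3 h4 _]|]; last by rewrite mul0r mulr0.
by rewrite hij in h3; lia.
Qed.

(** By [alt_lead] one curve is enough, and it is taken with last coordinate 0. Then [vdm] gains
    (-1)^n times the product of the other nodes, which cancels against the [-2 * t i] of
    [row_identity] and leaves the constant (-1)^n / 2. *)
Lemma lead_row_step m n k (L : {ffun 'I_n -> 'I_m.+1} -> rat) :
  (forall i, (i < n)%N -> (k i <= k i.+1)%N) -> (forall i, (i <= n)%N -> (k i <= m)%N) ->
  (forall a : {ffun 'I_n -> 'I_m.+1}, (forall i j : 'I_n, j = i.+1 :> nat -> (a i <= a j)%N) ->
     lead (gt_term m (vals a)) (L a)) ->
  lead (gt_term m (fun c : 'I_n.+1 => k c))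
    ((-1) ^+ n / 2 * \sum_(a : {ffun 'I_n -> 'I_m.+1}) row_weight rat k (vals a) * L a).
Proof.
move=> k_inc k_le hL.
have [L' hL'] := alt_lead (separated_gt_term rat m (fun c : 'I_n.+1 => k c)).
suff <- : L' = (-1) ^+ n / 2 * \sum_(a : {ffun 'I_n -> 'I_m.+1}) row_weight rat k (vals a) * L a by exact: hL'.
pose t := ins ord_max 0 (@pts n).
have t0 i : (t i).[0] = 0.
  by rewrite /t /ins; case: unlift => [j|] /=; rewrite ?pts0 ?horner0.
have [g' [hg' <-]] := hL' t t0.
have /fin_all_exists [g hg] (a : {ffun 'I_n -> 'I_m.+1}) :
    exists g, row_weight rat k (vals a) != 0 -> alt (gt_term m (vals a)) (@pts n) = vdm (@pts n) * g /\ g.[0] = L a.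
  have [ha|ha] := boolP [forall i : 'I_n, forall j : 'I_n, (j == i.+1 :> nat) ==> (a i <= a j)%N].
    have [|g hg] := hL a _ _ (@pts0 n); last by exists g.
    by move=> i j /eqP e; have /forallP/(_ i)/forallP/(_ j)/implyP := ha; apply.
  exists 0 => /eqP[]; move: ha; rewrite negb_forall => /existsP[i].
  rewrite negb_forall => /existsP[j]; rewrite negb_imply -ltnNge => /andP[/eqP e h].
  exact: row_weight_eq0 e h.
have two0 : (2 : {poly rat}) != 0 by rewrite -polyC_natr polyC_eq0.
have := row_identity two0 k_inc k_le (@pts n).
rewrite -/t hg'.
have -> : \sum_(a : {ffun 'I_n -> 'I_m.+1}) row_weight {poly rat} k (vals a) * alt (gt_term m (vals a)) (@pts n)
   = vdm (@pts n) * \sum_(a : {ffun 'I_n -> 'I_m.+1}) (row_weight rat k (vals a))%:P * g a.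
  rewrite mulr_sumr; apply: eq_bigr => a _; rewrite -(rmorph_row_weight (@polyC rat)).
  have [->|h] := eqVneq (row_weight rat k (vals a)) 0; first by rewrite rmorph0 !mul0r mulr0.
  by have [-> _] := hg a h; rewrite mulrCA.
have -> : vdm t = (-1) ^+ n * \prod_(i < n) (@pts n i) * vdm (@pts n).
  rewrite (vdm_lift ord_max); congr (_ * _ * _).
    by apply: eq_bigr => i _; rewrite /t ins_lift ins_id subr0.
  by apply: eq_bigr => j _; apply: eq_bigr => i _; rewrite /t /= !ins_lift.
have V0 := vdm_pts_neq0 n.
have P0 : \prod_(i < n) (@pts n i) != 0 by apply/prodf_neq0 => i _; apply: pts_neq0.
rewrite big_split /= prodr_const card_ord.
set G := \sum_(a : _) _ => H.
have {H} : (-1) ^+ n * 2 ^+ n * G = 2 ^+ n.+1 * g'.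
  apply: (mulfI (mulf_neq0 V0 P0)); move: H; rewrite (exprNn 2).
  have [->|->] : (-1) ^+ n = 1 :> {poly rat} \/ (-1) ^+ n = -1 :> {poly rat}.
  - by rewrite -signr_odd; case: odd; [right|left].
  - by move=> H; apply: etrans (etrans _ H) _; ring.
  - by move=> H; apply: etrans (etrans _ H) _; ring.
move/(congr1 (fun p => p.[0])); rewrite !hornerM !horner_exp hornerN !hornerC.
have -> : G.[0] = \sum_(a : {ffun 'I_n -> 'I_m.+1}) row_weight rat k (vals a) * L a.
  rewrite horner_sum; apply: eq_bigr => a _; rewrite hornerM hornerC.
  have [->|h] := eqVneq (row_weight rat k (vals a)) 0; first by rewrite !mul0r.
  by have [_ ->] := hg a h.
have -> : (2 : {poly rat}).[0] = 2 by rewrite -polyC_natr hornerC.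
rewrite exprS => e; have h2 : (2 ^+ n : rat) != 0 by rewrite expf_neq0.
apply: (mulfI h2); apply: (@mulfI _ 2) => //; rewrite [LHS]mulrA -e; by field.
Qed.

(** * Removing the bottom row of a pattern *)

(** Patterns are stored on a full square, so a bottom row [k] comes with a column [col] above the
    diagonal, which [normalized] forces to be 0. *)
Definition add_row n X (p : {ffun pos n -> X}) (k : {ffun 'I_n.+1 -> X}) (col : {ffun 'I_n -> X}) : {ffun pos n.+1 -> X} :=
  [ffun q : pos n.+1 =>
    if unlift ord_max q.1 is Some r then
      if unlift ord_max q.2 is Some c then p (r, c) else col r
    else k q.2].

Lemma add_row_bij n (X : finType) :
  bijective (fun q : {ffun pos n -> X} * {ffun 'I_n.+1 -> X} * {ffun 'I_n -> X} => add_row q.1.1 q.1.2 q.2).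
Proof.
exists (fun f : {ffun pos n.+1 -> X} =>
  ([ffun q : pos n => f (lift ord_max q.1, lift ord_max q.2)], [ffun c => f (ord_max, c)],
   [ffun r => f (lift ord_max r, ord_max)])) => [[[p k] col]|f] /=.
  congr (_, _, _); apply/ffunP.
  - by case=> r c; rewrite !ffunE /= !liftK.
  - by move=> c; rewrite !ffunE /= unlift_none.
  - by move=> r; rewrite !ffunE /= liftK unlift_none.
apply/ffunP => -[r c]; rewrite ffunE /=.
case: (unliftP ord_max r) => [r'|] ->; last by rewrite ffunE.
by case: (unliftP ord_max c) => [c'|] ->; rewrite ffunE.
Qed.

Lemma sum_add_row (V : nmodType) n (X : finType) (F : {ffun pos n.+1 -> X} -> V) :
  \sum_f F f = \sum_p \sum_k \sum_col F (add_row p k col).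
Proof.
rewrite (reindex _ (onW_bij _ (@add_row_bij n X))) /=.
rewrite pair_bigA pair_bigA /=; apply: eq_bigl => q; by [].
Qed.

Lemma get_ord n X (f : {ffun pos n -> X}) x0 (r c : 'I_n) : get f x0 r c = f (r, c).
Proof. by rewrite /get !valK. Qed.

Definition row_get n X (k : {ffun 'I_n -> X}) (x0 : X) (c : nat) : X := oapp k x0 (insub c).

Lemma row_get_ord n X (k : {ffun 'I_n -> X}) x0 (c : 'I_n) : row_get k x0 c = k c.
Proof. by rewrite /row_get valK. Qed.

Lemma get_add_row_last n X (p : {ffun pos n -> X}) k col x0 c :
  get (add_row p k col) x0 n c = row_get k x0 c.
Proof.
rewrite /get /row_get -[n in insub n]/(val (@ord_max n)) valK.
by case: insubP => [c' _ _|_] //=; rewrite ffunE /= unlift_none.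
Qed.

Lemma insub_ord n r (hr : (r < n)%N) : insub r = Some (Ordinal hr) :> option 'I_n.
Proof. exact: insubT. Qed.

Lemma get_add_row n X (p : {ffun pos n -> X}) k x0 r c : (r < n)%N ->
  get (add_row p k [ffun=> x0]) x0 r c = get p x0 r c.
Proof.
move=> hr; have hr1 : (r < n.+1)%N by apply: ltnW.
have er : Ordinal hr1 = lift ord_max (Ordinal hr) by apply: val_inj; rewrite /= /bump leqNgt hr.
rewrite /get (insub_ord hr1) (insub_ord hr) er.
have [hc|hc] := ltnP c n.
  have hc1 : (c < n.+1)%N by apply: ltnW.
  have ec : Ordinal hc1 = lift ord_max (Ordinal hc) by apply: val_inj; rewrite /= /bump leqNgt hc.
  by rewrite (insub_ord hc1) (insub_ord hc) ec ffunE /= !liftK.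
rewrite [in RHS]insubN -?leqNgt //; case: insubP => //= c' _ ec.
have -> : c' = ord_max by apply: val_inj => /=; have := ltn_ord c'; rewrite ec; lia.
by rewrite ffunE /= liftK unlift_none ffunE.
Qed.

Section Weight.
Variable m : nat.

Definition decoration_sign (D : nat -> nat -> 'I_4) (r : nat) : rat := \prod_(c < r.+1) (-1) ^+ isDouble (D r c).
Definition interlacing_weight (A : nat -> nat -> nat) (D : nat -> nat -> 'I_4) (r : nat) : rat :=
  \prod_(c < r.+1) interval_weight rat (A r.+1 c) (A r.+1 c.+1) (hasNE (D r.+1 c)) (hasNW (D r.+1 c.+1)) (A r c).

(** Signs and conditions as one product of local weights, zero where a condition fails. Strictness
    of the bottom row is left out so that rows can be removed one by one. *)
Definition pattern_weight n (a : {ffun pos n -> 'I_m.+1}) (d : {ffun pos n -> 'I_4}) : rat :=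
  if normalized a d
  then \prod_(r < n) decoration_sign (dec d) r * \prod_(r < n.-1) interlacing_weight (ent a) (dec d) r
  else 0.

Lemma normalized_add_row n (p : {ffun pos n -> 'I_m.+1}) (k : {ffun 'I_n.+1 -> 'I_m.+1}) col
    (p' : {ffun pos n -> 'I_4}) (k' : {ffun 'I_n.+1 -> 'I_4}) col' :
  normalized (add_row p k col) (add_row p' k' col') =
  [&& normalized p p', col == [ffun=> ord0] & col' == [ffun=> ord0]].
Proof.
apply/forallP/and3P => [h|[/forallP h /eqP -> /eqP ->] [r c]].
- split.
  + apply/forallP => -[r c]; have := h (lift ord_max r, lift ord_max c).
    by rewrite /= !ffunE /= !liftK -(lift_lt ord_max r c).
  + apply/eqP/ffunP => r; have := h (lift ord_max r, ord_max).
    rewrite /= !ffunE /= liftK unlift_none.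
    have -> : (bump n r < n)%N by have := ltn_ord r; rewrite /bump; lia.
    by move=> /andP[/eqP e _]; apply: val_inj.
  + apply/eqP/ffunP => r; have := h (lift ord_max r, ord_max).
    rewrite /= !ffunE /= liftK unlift_none.
    have -> : (bump n r < n)%N by have := ltn_ord r; rewrite /bump; lia.
    by move=> /andP[_ /eqP e]; apply: val_inj.
apply/implyP => /=; rewrite !ffunE /=.
case: (unliftP ord_max r) => [r'|] -> /=; last by have := ltn_ord c; rewrite ltnS leqNgt => /negPf ->.
case: (unliftP ord_max c) => [c'|] -> /=; last by rewrite !ffunE.
by have /implyP := h (r', c'); rewrite -(lift_lt ord_max r' c').
Qed.

Definition nat_row n (k : {ffun 'I_n -> 'I_m.+1}) (c : nat) : nat := row_get k ord0 c.

Lemma sum_normalized_row n (F : {ffun pos n.+1 -> 'I_m.+1} -> {ffun pos n.+1 -> 'I_4} -> rat) :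
  (forall a d, ~~ normalized a d -> F a d = 0) ->
  \sum_a \sum_d F a d = \sum_(k : {ffun 'I_n.+1 -> 'I_m.+1}) \sum_p \sum_p' \sum_k'
     F (add_row p k [ffun=> ord0]) (add_row p' k' [ffun=> ord0]).
Proof.
move=> F0; rewrite sum_add_row exchange_big /=; apply: eq_bigr => k _; apply: eq_bigr => p _.
rewrite (bigD1 [ffun=> ord0]) //= [X in _ + X]big1 ?addr0 => [|col hcol]; last first.
  rewrite sum_add_row big1 // => p' _; rewrite big1 // => k' _; rewrite big1 // => col' _.
  by rewrite F0 // normalized_add_row (negPf hcol) andbF.
rewrite sum_add_row; apply: eq_bigr => p' _; apply: eq_bigr => k' _.
rewrite (bigD1 [ffun=> ord0]) //= big1 ?addr0 // => col hcol.
by rewrite F0 // normalized_add_row (negPf hcol) !andbF.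
Qed.

Lemma pattern_weight_add_row n (p : {ffun pos n.+1 -> 'I_m.+1}) (k : {ffun 'I_n.+2 -> 'I_m.+1})
    (p' : {ffun pos n.+1 -> 'I_4}) (k' : {ffun 'I_n.+2 -> 'I_4}) :
  pattern_weight (add_row p k [ffun=> ord0]) (add_row p' k' [ffun=> ord0]) =
  pattern_weight p p' * ((\prod_c (-1) ^+ isDouble (k' c)) *
    \prod_(i < n.+1) interval_weight rat (nat_row k i) (nat_row k i.+1) (hasNE (k' (widen_ord (leqnSn n.+1) i)))
        (hasNW (k' (lift ord0 i))) (vals [ffun c => p (ord_max, c)] i)).
Proof.
rewrite /pattern_weight normalized_add_row !eqxx !andbT; case: ifP => _; last by rewrite mul0r.
have eA r c : (r < n.+1)%N -> ent (add_row p k [ffun=> ord0]) r c = ent p r c.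
  by move=> hr; rewrite /ent get_add_row.
have eD r c : (r < n.+1)%N -> dec (add_row p' k' [ffun=> ord0]) r c = dec p' r c.
  by move=> hr; rewrite /dec get_add_row.
have eAl c : ent (add_row p k [ffun=> ord0]) n.+1 c = nat_row k c.
  by rewrite /ent get_add_row_last.
have eDl (c : 'I_n.+2) : dec (add_row p' k' [ffun=> ord0]) n.+1 c = k' c.
  by rewrite /dec get_add_row_last row_get_ord.
rewrite big_ord_recr [\prod_(r < n.+2.-1) _]big_ord_recr /= mulrACA; congr (_ * _ * (_ * _)).
- by apply: eq_bigr => r _; apply: eq_bigr => c _; rewrite eD.
- apply: eq_bigr => r _; apply: eq_bigr => c _.
  have hr : (r.+1 < n.+1)%N by rewrite ltnS.
  by rewrite !(eA _ _ hr) !(eD _ _ hr) eA // ltnW.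
- by apply: eq_bigr => c _; rewrite eDl.
apply: eq_bigr => c _; rewrite !eAl eA //.
rewrite -[X in hasNE (dec _ _ X)]/(val (widen_ord (leqnSn n.+1) c)) eDl.
rewrite -[X in hasNW (dec _ _ X)]/(val (lift ord0 c)) eDl.
by rewrite /vals ffunE /ent -[n]/(val (@ord_max n)) get_ord.
Qed.

(** Signed count of the patterns with r + 1 rows and bottom row [k]; a single entry counts 1 + 1 + 1
    - 1 = 2. *)
Fixpoint row_count (r : nat) (k : nat -> nat) : rat :=
  if r is r'.+1 then \sum_(a : {ffun 'I_r'.+1 -> 'I_m.+1}) row_weight rat k (vals a) * row_count r' (nat_row a)
  else 2.

(** The arbitrary [f] carries the induction: once the bottom row is removed, its [row_weight]
    becomes the [f] of the row above. *)
Lemma sum_pattern_weight n (f : {ffun 'I_n.+1 -> 'I_m.+1} -> rat) :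
  \sum_(a : {ffun pos n.+1 -> 'I_m.+1}) \sum_(d : {ffun pos n.+1 -> 'I_4}) pattern_weight a d * f [ffun c => a (ord_max, c)] =
  \sum_(k : {ffun 'I_n.+1 -> 'I_m.+1}) f k * row_count n (nat_row k).
Proof.
elim: n f => [|n IH] f; rewrite sum_normalized_row; try by move=> a d /negPf h; rewrite /pattern_weight h mul0r.
  apply: eq_bigr => k _.
  transitivity (\sum_(p : {ffun pos 0 -> 'I_m.+1}) \sum_(p' : {ffun pos 0 -> 'I_4})
      \sum_(k' : {ffun 'I_1 -> 'I_4}) (\prod_c (-1) ^+ isDouble (k' c)) * f k).
    apply: eq_bigr => p _; apply: eq_bigr => p' _; apply: eq_bigr => k' _.
    congr (_ * f _); last by apply/ffunP => c; rewrite !ffunE /= unlift_none.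
    rewrite /pattern_weight normalized_add_row !eqxx !andbT.
    have -> : normalized p p' by apply/forallP => -[[]].
    rewrite big_ord0 mulr1 big_ord1; apply: eq_bigr => c _.
    by rewrite /dec get_add_row_last row_get_ord.
  rewrite !sumr_const !card_ffun !card_prod !card_ord muln0 !expn0 !mulr1n -mulr_suml mulrC.
  rewrite -(bigA_distr_bigA (fun (_ : 'I_1) (e : 'I_4) => (-1) ^+ isDouble e : rat)).
  by rewrite big_ord1 !big_ord_recl big_ord0 /isDouble /= expr0 expr1; congr (_ * _); ring.
apply: eq_bigr => k _ /=.
have <- := IH (fun a => row_weight rat (nat_row k) (vals a)).
rewrite mulr_sumr; apply: eq_bigr => p _; rewrite mulr_sumr; apply: eq_bigr => p' _.
rewrite /row_weight !mulr_sumr; apply: eq_bigr => k' _.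
rewrite pattern_weight_add_row mulrC; congr (f _ * _); apply/ffunP => c.
by rewrite !ffunE /= unlift_none.
Qed.

Lemma sum_triangle n (F : nat -> nat -> nat) :
  (\sum_(q : pos n | q.2 <= q.1) F q.1 q.2 = \sum_(r < n) \sum_(c < r.+1) F r c)%N.
Proof.
transitivity (\sum_(r < n) \sum_(c < n | c <= r) F r c)%N; first by rewrite pair_big_dep.
apply: eq_bigr => r _; rewrite (big_ord_widen n (F r) (ltn_ord r)).
by apply: eq_bigl => c; rewrite ltnS.
Qed.

(** The NE condition at (r + 1, c) and the NW condition at (r + 1, c + 1) both compare with the
    entry (r, c), so all conditions regroup into one [cond r c] per entry above the bottom row. *)
Lemma pattern_weightE n (a : {ffun pos n.+1 -> 'I_m.+1}) (d : {ffun pos n.+1 -> 'I_4}) :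
  pattern_weight a d = if [&& normalized a d, GT_ok a & arrow_ok a d] then sgn (a, d) * (-1) ^+ num_double (a, d) else 0.
Proof.
rewrite /pattern_weight; case: (normalized a d) => //=.
pose A := ent a; pose D := dec d.
pose cond r c := [&& A r.+1 c <= A r c, A r c <= A r.+1 c.+1,
   ((A r.+1 c == A r c) && hasNE (D r.+1 c)) ==> ((A r.+1 c.+1 == A r.+1 c) && hasNW (D r.+1 c.+1))
   & ((A r.+1 c.+1 == A r c) && hasNW (D r.+1 c.+1)) ==> ((A r.+1 c == A r.+1 c.+1) && hasNE (D r.+1 c))]%N.
pose sp r c := [&& A r.+1 c == A r c, A r.+1 c.+1 == A r c, hasNE (D r.+1 c) & hasNW (D r.+1 c.+1)].
have -> : \prod_(r < n.+1) decoration_sign D r = (-1) ^+ num_double (a, d).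
  rewrite /num_double -sum1dep_card big_mkcondr /=.
  rewrite (eq_bigr (fun q : pos n.+1 => nat_of_bool (isDouble (D q.1 q.2)))) => [|[r c] _]; last first.
    by rewrite /D /dec get_ord /=; case: isDouble.
  rewrite (sum_triangle n.+1 (fun r c => nat_of_bool (isDouble (D r c)))) expr_sum.
  by apply: eq_bigr => r _; rewrite expr_sum.
have sgnE : sgn (a, d) = \prod_(r < n) \prod_(c < r.+1) (-1) ^+ sp r c.
  rewrite /sgn /num_special -sum1dep_card.
  rewrite (eq_bigl (fun q : pos n.+1 => (q.2 <= q.1)%N && ((q.1.+1 < n.+1)%N && sp q.1 q.2))) //.
  rewrite big_mkcondr /= (eq_bigr (fun q : pos n.+1 => nat_of_bool ((q.1.+1 < n.+1)%N && sp q.1 q.2))) => [|q _];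
    last by case: andb.
  rewrite (sum_triangle n.+1 (fun r c => nat_of_bool ((r.+1 < n.+1)%N && sp r c))).
  rewrite expr_sum big_ord_recr /= [X in _ * X](_ : _ = 1) ?mulr1; last first.
    by rewrite big1 // => c _; rewrite ltnn.
  apply: eq_bigr => r _; rewrite expr_sum; apply: eq_bigr => c _.
  by rewrite ltnS ltn_ord.
have condP : reflect (forall r c, (r < n)%N -> (c <= r)%N -> cond r c) (GT_ok a && arrow_ok a d).
  apply: (iffP andP) => [[/forallP hG /forallP hA] r c hr hc|h].
    have hr1 : (r < n.+1)%N by apply: ltnW.
    have hr2 : (r.+1 < n.+1)%N by [].
    have hc1 : (c < n.+1)%N by apply: leq_ltn_trans hc hr1.
    have hc2 : (c.+1 < n.+1)%N by apply: leq_ltn_trans hr2.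
    have /forallP /(_ (Ordinal hc1)) /= := hG (Ordinal hr1); rewrite hc hr2 /= => /andP[g1 g2].
    have /forallP /(_ (Ordinal hc1)) /= := hA (Ordinal hr2).
    rewrite (leq_trans hc (leqnSn r)) /= ltnS hc /= => /andP[a1 _].
    have /forallP /(_ (Ordinal hc2)) /= := hA (Ordinal hr2).
    rewrite ltnS hc /= => /andP[_ a2].
    by rewrite /cond /A /D g1 g2 a1 a2.
  split; apply/forallP => r; apply/forallP => c; apply/implyP.
    move=> /andP[hc hr]; rewrite ltnS in hr.
    by have /and4P[-> -> _ _] := h r c hr hc.
  move=> hc; apply/andP; split; apply/implyP.
    move=> /andP[/andP[/andP[r0 hcr] e] ne].
    case: r r0 hc hcr e ne => -[//|r] hr _ hc hcr /= e ne.
    by have /and4P[_ _ /implyP + _] := h r c hr hcr; rewrite /A /D e ne; apply.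
  move=> /andP[/andP[/andP[r0 c0] e] ne].
  case: r r0 hc e ne => -[//|r] hr _; case: c c0 => -[//|c] hc' _ /= hc e ne.
  by have /and4P[_ _ _ /implyP] := h r c hr hc; rewrite /A /D e ne; apply.
have omE r c : interval_weight rat (A r.+1 c) (A r.+1 c.+1) (hasNE (D r.+1 c)) (hasNW (D r.+1 c.+1)) (A r c)
    = if cond r c then (-1) ^+ sp r c else 0 by [].
case: condP => [h|h]; rewrite mulrC.
  rewrite sgnE; congr (_ * _); apply: eq_bigr => r _; apply: eq_bigr => c _.
  by rewrite omE h // -ltnS.
have [/existsP[r /existsP[c /andP[hc hn]]]|h0] :=
    boolP [exists r : 'I_n, [exists c : 'I_n.+1, (c <= r)%N && ~~ cond r c]].
  rewrite (bigD1 r) //= /interlacing_weight; have hc' : (c < r.+1)%N by [].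
  by rewrite (bigD1 (Ordinal hc')) //= omE (negPf hn) !mul0r.
case: h => r c hr hc; apply/negPn/negP => hn; case/negP: h0.
have hc1 : (c < n.+1)%N by lia.
by apply/existsP; exists (Ordinal hr); apply/existsP; exists (Ordinal hc1); rewrite /= hc.
Qed.

Lemma sum_arrowed n : \sum_(p : {ffun pos n.+1 -> 'I_m.+1} * {ffun pos n.+1 -> 'I_4} | arrowed_GT p)
    sgn p * (-1) ^+ num_double p =
  \sum_(k : {ffun 'I_n.+1 -> 'I_m.+1} | strict (vals k)) row_count n (nat_row k).
Proof.
rewrite [RHS]big_mkcond /=.
transitivity (\sum_(k : {ffun 'I_n.+1 -> 'I_m.+1}) (strict (vals k))%:R * row_count n (nat_row k)); last first.
  by apply: eq_bigr => k _; case: strict; rewrite ?mul1r ?mul0r.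
rewrite -(sum_pattern_weight (fun k => (strict (vals k))%:R)) pair_bigA big_mkcond /=.
apply: eq_bigr => -[a d] _ /=; rewrite pattern_weightE /arrowed_GT /=.
have -> : bottom_strict a = strict (vals [ffun c => a (ord_max, c)]).
  have eE (c : 'I_n.+1) : vals [ffun c => a (ord_max, c)] c = ent a n c.
    by rewrite /vals ffunE /ent -[n]/(val (@ord_max n)) get_ord.
  apply/forallP/strictP => [h i j hij|h c].
    have H e c : (c + e.+1 < n.+1)%N -> (ent a n c < ent a n (c + e.+1))%N.
      have hS c' : (c'.+1 < n.+1)%N -> (ent a n c' < ent a n c'.+1)%N.
        move=> hc; have hc1 : (c' < n.+1)%N by apply: ltnW.
        by have /implyP := h (Ordinal hc1); apply.
      elim: e => [|e IH] hc; first by rewrite addn1; apply: hS; rewrite -addn1.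
      have hc' : (c + e.+1 < n.+1)%N by lia.
      have e2 : (c + e.+2 = (c + e.+1).+1)%N by lia.
      by apply: ltn_trans (IH hc') _; rewrite e2; apply: hS; rewrite -e2.
    rewrite !eE; have := H (j - i).-1 i.
    have -> : (i + (j - i).-1.+1 = j)%N by lia.
    by apply; apply: ltn_ord.
  apply/implyP => hc; rewrite /= -eE -[c.+1]/(val (Ordinal hc)) -eE.
  by apply: h => /=.
by case: (normalized a d); case: (GT_ok a); case: (arrow_ok a d); case: strict; rewrite /= ?mulr1 ?mulr0 ?mul0r.
Qed.

(** The constant accumulates the factors of [lead_row_step]; for a single row the value is 1, that
    is, half of [row_count 0 k]. *)
Lemma lead_row_count r (k : nat -> nat) :
  (forall i, (i < r)%N -> (k i <= k i.+1)%N) -> (forall i, (i <= r)%N -> (k i <= m)%N) ->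
  lead (gt_term m (fun c : 'I_r.+1 => k c)) ((-1) ^+ 'C(r.+1, 2) / 2 ^+ r.+1 * row_count r k).
Proof.
elim: r k => [|r IH] k k_inc k_le.
  move=> t t0; exists (bernstein m (k 0%N) (t ord0)); split; last first.
    by rewrite /bernstein hornerM !horner_exp !hornerE t0 ?subr0 ?addr0 !expr1n.
  rewrite /vdm big_ord1 big_pred0 ?mul1r => [|i]; last by rewrite ltn0.
  rewrite /alt (big_pred1 1%g) => [|s]; last first.
    by apply/esym/eqP/permP => i; rewrite !(ord1 (_ i)).
  rewrite odd_perm1 expr0 mul1r /gt_term /pair_prod !big_ord1 [X in _ * X]big_pred0 ?mulr1 /= ?perm1 //.
pose L (a : {ffun 'I_r.+1 -> 'I_m.+1}) := (-1) ^+ 'C(r.+1, 2) / 2 ^+ r.+1 * row_count r (nat_row a).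
have := @lead_row_step m r.+1 k L k_inc k_le.
have -> : (-1) ^+ r.+1 / 2 * (\sum_(a : {ffun 'I_r.+1 -> 'I_m.+1}) row_weight rat k (vals a) * L a)
    = (-1) ^+ 'C(r.+2, 2) / 2 ^+ r.+2 * row_count r.+1 k.
  rewrite /= !mulr_sumr; apply: eq_bigr => a _; rewrite /L.
  have h2 : (2 : rat) ^+ r.+1 != 0 by rewrite expf_neq0.
  have cE : 'C(r.+2, 2) = ('C(r.+1, 2) + r.+1)%N by rewrite binS bin1.
  rewrite cE exprD [2 ^+ r.+2]exprS; move: (2 ^+ r.+1) h2 => x h2.
  by field.
apply=> a ha t t0.
have nE (c : 'I_r.+1) : nat_row a c = a c by rewrite /nat_row row_get_ord.
have [|i hi|g [hg hg0]] := IH (nat_row a) _ _ t t0.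
- move=> i hi; have h1 : (i < r.+1)%N by apply: ltnW.
  by rewrite -[i]/(val (Ordinal h1)) nE -[(val _).+1]/(val (Ordinal (hi : (i.+1 < r.+1)%N))) nE ha.
- by rewrite -[i]/(val (Ordinal (hi : (i < r.+1)%N))) nE -ltnS.
exists g; split=> //; rewrite -hg; apply: eq_alt => s.
by apply: gt_term_ext => // c; rewrite nE.
Qed.
End Weight.

(** * Assembling the enumeration formula *)

Lemma rhs_eq0 (n m : nat) : (m.+1 < n)%N ->
  \prod_(1 <= i < n.+1)
      (poch (m%:R - n%:R + 3%:R * i%:R + 1) i.-1 * poch (m%:R - n%:R + i%:R + 1) i
       / (poch ((m%:R - n%:R + i%:R + 2%:R) / 2%:R) i.-1 * poch i%:R i)) = 0.
Proof.
(* For this index m - n + i + 1 = 0. Denominators of other factors may vanish as well; in [rat] such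
   factors are 0. *)
move=> hmn; have hi : (n - m.+1)%N \in index_iota 1 n.+1 by rewrite mem_index_iota; lia.
rewrite (bigD1_seq _ hi) ?iota_uniq //=.
have -> : m%:R - n%:R + (n - m.+1)%:R + 1 = 0 :> rat.
  by rewrite natrB ?(ltnW hmn) // -natr1; ring.
have -> : (n - m.+1 = (n - m.+2).+1)%N by lia.
by rewrite [poch 0 _]pochSl !(mul0r, mulr0).
Qed.

Lemma strict_leq n m (k : {ffun 'I_n -> 'I_m.+1}) : strict (vals k) -> (n <= m.+1)%N.
Proof.
move=> /strictP hk; have kinj : injective k.
  move=> i j e; apply: val_inj => /=.
  by case: (ltngtP i j) => // /hk; rewrite /vals e ltnn.
by have := leq_card k kinj; rewrite !card_ord.
Qed.

Theorem theorem1p1 (n m : nat) (hn : (1 <= n)%N) :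
  \sum_(p : {ffun pos n -> 'I_m.+1} * {ffun pos n -> 'I_4} | arrowed_GT p)
     sgn p * (-1) ^+ num_double p
  = 2%:R ^+ n *
    \prod_(1 <= i < n.+1)
      (poch (m%:R - n%:R + 3%:R * i%:R + 1) i.-1 * poch (m%:R - n%:R + i%:R + 1) i
       / (poch ((m%:R - n%:R + i%:R + 2%:R) / 2%:R) i.-1 * poch i%:R i)).
Proof.
case: n hn => // n _; rewrite sum_arrowed.
(* With more columns than available values no bottom row is strictly increasing, and both sides are
   0. *)
have [hmn|hmn] := ltnP m.+1 n.+1.
  rewrite rhs_eq0 // mulr0 big_pred0 // => k; apply/negP => /strict_leq.
  by rewrite leqNgt hmn.
pose L (k : {ffun 'I_n.+1 -> 'I_m.+1}) := (-1) ^+ 'C(n.+1, 2) / 2 ^+ n.+1 * row_count m n (nat_row k).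
have hL (k : {ffun 'I_n.+1 -> 'I_m.+1}) : strict (vals k) -> lead (gt_term m (vals k)) (L k).
  move=> /strictP hk t t0.
  have nE (c : 'I_n.+1) : nat_row k c = k c by rewrite /nat_row row_get_ord.
  have [|i hi|g [hg hg0]] := @lead_row_count m n (nat_row k) _ _ t t0.
  - move=> i hi; have h1 : (i < n.+1)%N by apply: ltnW.
    rewrite -[i]/(val (Ordinal h1)) nE -[(val _).+1]/(val (Ordinal (hi : (i.+1 < n.+1)%N))) nE.
    by apply: ltnW; apply: hk.
  - by rewrite -[i]/(val (Ordinal (hi : (i < n.+1)%N))) nE -ltnS.
  exists g; split=> //; rewrite -hg; apply: eq_alt => s.
  by apply: gt_term_ext => // c; rewrite nE.
have := sum_lead hL; rewrite -mulr_sumr tau_detE //=; last exact: leq_trans (leqnSn n) hmn.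
have h2 : (2 : rat) ^+ n.+1 != 0 by rewrite expf_neq0.
have hs : (-1) ^+ 'C(n.+1, 2) != 0 :> rat by rewrite signr_eq0.
(* The sign accumulated over the rows equals the one in [sum_lead], so they cancel. *)
rewrite -mulrA => /(mulfI hs) /(congr1 (fun x => 2 ^+ n.+1 * x)); rewrite mulVKf // => ->.
congr (_ * _); apply: eq_bigr => i _; rewrite /rhs_factor.
have -> : (m.+1 - n)%:R = m%:R - n.+1%:R + 2 :> rat.
  by rewrite natrB ?(leq_trans (leqnSn n) hmn) // -!natr1; ring.
by congr (poch _ _ * poch _ _ / (poch (_ / _) _ * _)); ring.
Qed.
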